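(* Consider either the white noise model or the Gaussian sequence model with noise level $n^{-1/2}$, and let $T$ be a linear functional. Suppose $\mathcal{F}$ and $\mathcal{G}$ are convex and closed with nonempty intersection and $\omega(1,\mathcal{F},\mathcal{G})>0$, and let $V\ge0$ be in one of the cases 1(a), 1(b), 2(a), 2(b) listed in the context. Let $(u,a)$ be the limit direction and limit constant constructed in the context. Then the estimator $\hat T_V=a+\sqrt{nV}\int u(t)\,dY(t)$ (white noise model), resp. $\hat T_V=a+\sqrt{nV}\sum_i u(i)Y(i)$ (sequence model), satisfies $$E(\hat T_V-E\hat T_V)^2\le V,$$ $$\sup_{f\in\mathcal{F}}\big(E_f\hat T_V-Tf\big)\le B(V,\mathcal{F},\mathcal{G}),$$ and $$\inf_{g\in\mathcal{G}}\big(E_g\hat T_V-Tg\big)\ge -B(V,\mathcal{F},\mathcal{G}).$$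
   Context: White noise model: one observes $dY(t)=f(t)\,dt+n^{-1/2}dW(t)$ on an interval, $W$ a standard Brownian motion. Sequence model: one observes $Y(i)=f(i)+n^{-1/2}\varepsilon_i$, $\varepsilon_i$ i.i.d. standard normal. $\langle\cdot,\cdot\rangle$ and $\|\cdot\|_2$ are the $L_2$ (resp. $\ell_2$) inner product and norm; parameter sets are subsets of this Hilbert space, ''closed'' is with respect to $\|\cdot\|_2$, and $T$ is a linear functional on a linear space containing the parameter sets. $E_h$ is expectation when the true parameter is $h$; for $u$ in the Hilbert space, $\int u\,dY$ (resp. $\sum_i u(i)Y(i)$) is, under $h$, normal with mean $\langle u,h\rangle$ and variance $\|u\|_2^2/n$. Ordered modulus: $\omega(\varepsilon,\mathcal{F},\mathcal{G})=\sup\{Tg-Tf:\|g-f\|_2\le\varepsilon,\ f\in\mathcal{F},\ g\in\mathcal{G}\}$. For $V\ge0$, $B(V,\mathcal{F},\mathcal{G})=\frac12\sup_{\varepsilon>0}\big(\omega(\varepsilon,\mathcal{F},\mathcal{G})-\sqrt{nV}\,\varepsilon\big)$. **Cases and $\varepsilon(V,\mathcal{F},\mathcal{G})$.** Case 1: $0<B(V,\mathcal{F},\mathcal{G})<\infty$; then $\varepsilon(V,\mathcal{F},\mathcal{G})$ is the smallest $\varepsilon\ge0$ at which $\omega(\varepsilon,\mathcal{F},\mathcal{G})-\sqrt{nV}\,\varepsilon$ attains its maximum ($\infty$ if the supremum is approached only as $\varepsilon\to\infty$). Case 1(a): $0<\varepsilon(V,\mathcal{F},\mathcal{G})<\infty$.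 Case 1(b): $\varepsilon(V,\mathcal{F},\mathcal{G})=\infty$. Case 2: $B(V,\mathcal{F},\mathcal{G})=0$ and $B(V',\mathcal{F},\mathcal{G})>0$ for all $0\le V'<V$. Case 2(a): moreover $\omega(\varepsilon,\mathcal{F},\mathcal{G})=\sqrt{nV}\,\varepsilon$ on some interval $0\le\varepsilon\le\varepsilon_0$, $\varepsilon_0>0$. Case 2(b): moreover $\omega(\varepsilon,\mathcal{F},\mathcal{G})<\sqrt{nV}\,\varepsilon$ for all $\varepsilon>0$. **Construction of $(u,a)$.** Let $\mathcal{F}_m,\mathcal{G}_m$ be the intersections of $\mathcal{F},\mathcal{G}$ with the closed $\|\cdot\|_2$-ball of radius $m$ centered at $0$. For all large $m$ choose $V_m$ and $l(m)$ as follows. - Case 1(a): $V_m=V$, $l(m)=m$. - Case 1(b): $V_m>V$ with $V_m\downarrow V$, and $l(m)\to\infty$ increasing with $B(V_m,\mathcal{F}_{l(m)},\mathcal{G}_{l(m)})>0$. - Case 2(a): $l(m)=m$ and $V_m<V$ with $0<B(V_m,\mathcal{F}_{l(m)},\mathcal{G}_{l(m)})\le\frac1m$. - Case 2(b): $V_m<V$ with $V_m\uparrow V$, and $l(m)\to\infty$ increasing with $0<B(V_m,\mathcal{F}_{l(m)},\mathcal{G}_{l(m)})<B(V_m,\mathcal{F},\mathcal{G})<\infty$. Let $\varepsilon_m=\varepsilon(V_m,\mathcal{F}_{l(m)},\mathcal{G}_{l(m)})$ (Case 1 definition applied to these sets; it is positive and finite for large $m$), and let $f_m\in\mathcal{F}_{l(m)}$,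 $g_m\in\mathcal{G}_{l(m)}$ be a pair attaining the modulus: $\|g_m-f_m\|_2=\varepsilon_m$ and $Tg_m-Tf_m=\omega(\varepsilon_m,\mathcal{F}_{l(m)},\mathcal{G}_{l(m)})$. Put $u_m=(g_m-f_m)/\varepsilon_m$ and $a_m=T\big(\frac{f_m+g_m}2\big)-\sqrt{nV_m}\,\big\langle u_m,\frac{f_m+g_m}2\big\rangle$. Then $\|u_m\|_2=1$ and $(a_m)$ is bounded, so along some subsequence $u_m$ converges weakly to some $u$ with $\|u\|_2\le1$ and $a_m$ converges to some $a\in\mathbb{R}$; $(u,a)$ is any such limit. *)

(* Defs.v *)
From HB Require Import structures.
From mathcomp Require Import all_boot all_order all_algebra.
From mathcomp Require Import all_classical all_reals all_analysis.
Set Implicit Arguments.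
Unset Strict Implicit.
Unset Printing Implicit Defensive.
Import Order.TTheory GRing.Theory Num.Theory.
Import numFieldNormedType.Exports.
Local Open Scope classical_set_scope.
Local Open Scope ring_scope.

(* Both models live in a Hilbert space L^2(mu): mu is Lebesgue measure on an
   interval (white noise) or counting measure on nat (sequences, giving l^2).
   Its elements are represented by square-integrable functions, and everything
   below is insensitive to modifying a function on a mu-null set. *)
Notation L2 mu := (LfunType mu (lee1n 2)).

Section HilbertSpace.
Context d (X : measurableType d) (R : realType).
Variable mu : {measure set X -> \bar R}.
Implicit Types (f g h : L2 mu) (F : set (L2 mu)).

Definition inner f g : R := \int[mu]_x (f x * g x).

Definition norm2 f : R := fine ('N[mu]_2%:E[EFin \o f])%E.

Definition closed2 F : Prop :=
  forall (s : nat -> L2 mu) f,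
    (forall k, F (s k)) -> norm2 (s k - f) @[k --> \oo] --> (0 : R) -> F f.

Definition weakly_cvg (s : nat -> L2 mu) f : Prop :=
  forall h, inner (s k) h @[k --> \oo] --> inner f h.

(* T is a linear functional on the linear subspace D of L^2(mu); T is not
   assumed continuous, and its values off D play no role.  The last clause says
   that T depends only on the a.e. class of its argument. *)
Definition linear_functional_on (D : set (L2 mu)) (T : L2 mu -> R) : Prop :=
  [/\ D 0,
      forall (c : R) f g, D f -> D g -> D (c *: f + g),
      forall (c : R) f g, D f -> D g -> T (c *: f + g) = c * T f + T g &
      forall f g, D f -> D g -> ae_eq mu setT f g -> T f = T g].

End HilbertSpace.

Section Modulus.
Context d (X : measurableType d) (R : realType).
Variables (mu : {measure set X -> \bar R}) (n : R) (T : L2 mu -> R).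
Implicit Types (F G : set (L2 mu)) (V : R).

Definition omega (e : R) F G : \bar R :=
  ereal_sup [set z | exists f g,
    [/\ F f, G g, norm2 (g - f) <= e & z = (T g - T f)%:E]].

Definition penalized V F G (e : R) : \bar R :=
  (omega e F G - (Num.sqrt (n * V) * e)%:E)%E.

Definition bias_bound V F G : \bar R :=
  (2^-1%:E * ereal_sup (penalized V F G @` `]0%R, +oo[%classic))%E.

(* epsilon(V, F, G) is a point of [0, +oo]: the smallest maximizer on [0, +oo[,
   or +oo if the supremum over each [0, K] is strictly below the global one,
   i.e. the supremum is approached only at infinity. *)
Definition is_epsilon V F G (e : \bar R) : Prop :=
  match e with
  | e0%:E =>
      [/\ 0 <= e0,
          forall e' : R, 0 <= e' ->
            (penalized V F G e' <= penalized V F G e0)%E &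
          forall e1 : R, 0 <= e1 ->
            (forall e' : R, 0 <= e' ->
              (penalized V F G e' <= penalized V F G e1)%E) -> e0 <= e1]
  | +oo%E =>
      forall K : R, 0 <= K ->
        (ereal_sup (penalized V F G @` `[0%R, K]%classic) <
         ereal_sup (penalized V F G @` `[0%R, +oo[%classic))%E
  | -oo%E => False
  end.

Definition case1 V F G : Prop := (0 < bias_bound V F G < +oo)%E.

Definition case1a V F G : Prop :=
  case1 V F G /\ exists e : R, 0 < e /\ is_epsilon V F G e%:E.

Definition case1b V F G : Prop := case1 V F G /\ is_epsilon V F G +oo%E.

Definition case2 V F G : Prop :=
  bias_bound V F G = 0%E /\
  forall V' : R, 0 <= V' < V -> (0 < bias_bound V' F G)%E.

Definition case2a V F G : Prop :=
  case2 V F G /\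
  exists e0 : R, 0 < e0 /\
    forall e : R, 0 <= e <= e0 -> omega e F G = (Num.sqrt (n * V) * e)%:E.

Definition case2b V F G : Prop :=
  case2 V F G /\
  forall e : R, 0 < e -> (omega e F G < (Num.sqrt (n * V) * e)%:E)%E.

Definition ball_part F (m : nat) : set (L2 mu) :=
  [set f | F f /\ norm2 f <= m%:R].

Definition bias_bound_part V F G (m : nat) : \bar R :=
  bias_bound V (ball_part F m) (ball_part G m).

(* The four cases together with the corresponding choices of V_m and l(m);
   m0 is the index from which on ("for all large m") the choices are made. *)
Definition admissible_choice V F G (m0 : nat) (Vs : nat -> R)
    (l : nat -> nat) : Prop :=
  [\/ case1a V F G /\
      (forall m, (m0 <= m)%N -> Vs m = V /\ l m = m),
      case1b V F G /\
      [/\ forall m, (m0 <= m)%N ->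
            V < Vs m /\ (0 < bias_bound_part (Vs m) F G (l m))%E,
          forall m m', (m0 <= m)%N -> (m <= m')%N ->
            Vs m' <= Vs m /\ (l m <= l m')%N,
          Vs m @[m --> \oo] --> V &
          l m @[m --> \oo] --> \oo],
      case2a V F G /\
      (forall m, (m0 <= m)%N ->
        [/\ 0 <= Vs m < V, l m = m &
            (0 < bias_bound_part (Vs m) F G (l m) <= (m%:R^-1)%:E)%E]) |
      case2b V F G /\
      [/\ forall m, (m0 <= m)%N ->
            0 <= Vs m < V /\
            (0 < bias_bound_part (Vs m) F G (l m) < bias_bound (Vs m) F G)%E /\
            (bias_bound (Vs m) F G < +oo)%E,
          forall m m', (m0 <= m)%N -> (m <= m')%N ->
            Vs m <= Vs m' /\ (l m <= l m')%N,
          Vs m @[m --> \oo] --> V &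
          l m @[m --> \oo] --> \oo]].

Definition direction (e : R) (f g : L2 mu) : L2 mu := e^-1 *: (g - f).

Definition constant V (e : R) (f g : L2 mu) : R :=
  T (2^-1 *: (f + g)) -
  Num.sqrt (n * V) * inner (direction e f g) (2^-1 *: (f + g)).

(* (u, a) is a limit, along a subsequence phi, of a sequence (u_m, a_m) given
   by some admissible choice of V_m, l(m), f_m and g_m. *)
Definition limit_pair V F G (u : L2 mu) (a : R) : Prop :=
  exists (m0 : nat) (Vs : nat -> R) (l : nat -> nat)
         (eps : nat -> R) (f g : nat -> L2 mu) (phi : nat -> nat),
  [/\ admissible_choice V F G m0 Vs l,
      forall m, (m0 <= m)%N ->
        is_epsilon (Vs m) (ball_part F (l m)) (ball_part G (l m)) (eps m)%:E,
      forall m, (m0 <= m)%N ->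
        [/\ ball_part F (l m) (f m), ball_part G (l m) (g m),
            norm2 (g m - f m) = eps m &
            (T (g m) - T (f m))%:E =
              omega (eps m) (ball_part F (l m)) (ball_part G (l m))],
      {homo phi : i j / (i < j)%N} &
      weakly_cvg (fun k =>
        direction (eps (phi k)) (f (phi k)) (g (phi k))) u /\
      constant (Vs (phi k)) (eps (phi k)) (f (phi k)) (g (phi k))
        @[k --> \oo] --> a].

End Modulus.

Section Observations.
Context (R : realType) d (Om : measurableType d).
Implicit Types (P : probability Om R).

Definition mutually_independent (J : choiceType) P (X : J -> Om -> R) : Prop :=
  forall (s : seq J) (A : J -> set R),
    uniq s -> (forall j, measurable (A j)) ->
    P (\big[setI/setT]_(j <- s) (X j @^-1` A j)) =
    (\prod_(j <- s) P (X j @^-1` A j))%E.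

Definition has_law_normal P (X : Om -> R) (m s : R) : Prop :=
  forall A : set R, measurable A -> P (X @^-1` A) = normal_prob m s A.

(* Standard Brownian motion indexed by the interval I, started at o in I. *)
Definition brownian_motion P (I : interval R) (o : R)
    (W : R -> {mfun Om >-> R}) : Prop :=
  [/\ o \in I,
      {ae P, forall w, W o w = 0},
      {ae P, forall w, {within [set` I], continuous (fun t => W t w)}},
      forall s t, s \in I -> t \in I -> s < t ->
        has_law_normal P (fun w => W t w - W s w) 0 (Num.sqrt (t - s)) &
      forall (m : nat) (t : nat -> R),
        (forall i, (i <= m)%N -> t i \in I) ->
        (forall i, (i < m)%N -> t i < t i.+1) ->
        mutually_independent P
          (fun (i : 'I_m) w => W (t i.+1) w - W (t i) w)].

Definition lebesgue_on (I : interval R) :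
    {measure set (measurableTypeR R) -> \bar R} :=
  mrestr (@lebesgue_measure R) (@measurable_itv R I).

(* dY(t) = h(t) dt + n^{-1/2} dW(t) on I under P h, in integrated form. *)
Definition white_noise_model (n : R) (I : interval R)
    (P : L2 (lebesgue_on I) -> probability Om R)
    (Y : R -> {mfun Om >-> R}) : Prop :=
  forall h : L2 (lebesgue_on I), exists (o : R) (W : R -> {mfun Om >-> R}),
    brownian_motion (P h) I o W /\
    {ae P h, forall w, forall s t, s \in I -> t \in I -> s <= t ->
      Y t w - Y s w =
        \int[lebesgue_measure]_(x in `[s, t]) h x +
        (Num.sqrt n)^-1 * (W t w - W s w)}.

Definition step_function (m : nat) (t c : nat -> R) (x : R) : R :=
  \sum_(i < m) c i * \1_(`]t i, t i.+1]%classic) x.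

Definition step_integral (m : nat) (t c : nat -> R) (Y : R -> Om -> R)
    (w : Om) : R :=
  \sum_(i < m) c i * (Y (t i.+1) w - Y (t i) w).

(* Z is (a version of) the stochastic integral of u against dY: the limit in
   mean square of integrals of step functions tending to u in L^2(I). *)
Definition is_integral_dY P (I : interval R) (Y : R -> {mfun Om >-> R})
    (u : L2 (lebesgue_on I)) (Z : Om -> R) : Prop :=
  exists (m : nat -> nat) (t c : nat -> nat -> R),
  [/\ forall k i, (i <= m k)%N -> t k i \in I,
      forall k i, (i < m k)%N -> t k i < t k i.+1,
      (\int[lebesgue_on I]_x
         ((step_function (m k) (t k) (c k) x - u x) ^+ 2)%:E)%E
        @[k --> \oo] --> 0%E &
      'E_P[fun w => ((Z w - step_integral (m k) (t k) (c k) Y w) ^+ 2)%R]%E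
        @[k --> \oo] --> 0%E].

Definition counting_nat : {measure set nat -> \bar R} := @counting nat R.

(* Y(i) = h(i) + n^{-1/2} xi(i) under P h, with xi i.i.d. standard normal. *)
Definition sequence_model (n : R)
    (P : L2 counting_nat -> probability Om R)
    (Y : nat -> {mfun Om >-> R}) : Prop :=
  forall h : L2 counting_nat, exists xi : nat -> {mfun Om >-> R},
    [/\ forall i, has_law_normal (P h) (xi i) 0 1,
        mutually_independent (P h) xi &
        {ae P h, forall w, forall i, Y i w = h i + (Num.sqrt n)^-1 * xi i w}].

Definition is_series_Y P (Y : nat -> {mfun Om >-> R})
    (u : L2 counting_nat) (Z : Om -> R) : Prop :=
  {ae P, forall w, (\sum_(i < k) u i * Y i w) @[k --> \oo] --> Z w}.

End Observations.

(* Main.v *)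
Require Import Defs.
From HB Require Import structures.
From mathcomp Require Import all_boot all_order all_algebra.
From mathcomp Require Import all_classical all_reals all_analysis.
From mathcomp Require Import measurable_realfun ring lra.
From mathcomp Require finmap.
Set Implicit Arguments.
Unset Strict Implicit.
Unset Printing Implicit Defensive.
Import Order.TTheory GRing.Theory Num.Theory.
Import numFieldNormedType.Exports.
Local Open Scope classical_set_scope.
Local Open Scope ring_scope.

(* Bias: at an extremal pair (f_m, g_m) the function
   (f, g) |-> Tg - Tf - sqrt(n V_m) ||g - f|| is maximal over the truncated sets,
   with maximal value twice their bias bound.  Its directional derivatives
   towards F and G at that pair are therefore nonpositive, which says that the
   affine functional a_m + sqrt(n V_m) <u_m, .> - T lies below that bias bound on
   F and above its opposite on G.  Both inequalities survive weak limits,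
   once V_m -> V and the bias bounds B(V_m, F_l(m), G_l(m)) are shown to be
   asymptotically at most B(V, F, G); in Case 2(b) this uses that the bias bound
   is convex in sqrt(V).

   Variance: in both models the integral of u against dY is a mean-square limit
   of sums sum_i c_i (<e_i, h> + n^{-1/2} xi_i), where the e_i are orthogonal, the
   xi_i are centred and uncorrelated, E xi_i^2 <= ||e_i||^2, and sum_i c_i e_i
   tends to u.  Hence it has mean <u, h> and variance at most ||u||^2 / n, and
   ||u|| <= 1 since norms do not increase under weak limits. *)

(** * Inner products *)

Section InnerProduct.
Context {d : measure_display} {X : measurableType d} {R : realType}.
Context {mu : {measure set X -> \bar R}}.
Implicit Types f g h : L2 mu.

Lemma integrable_mulL2 f g :
  mu.-integrable setT (EFin \o (fun x => f x * g x)).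
Proof.
by apply/Lfun1_integrable/Lfun2_mul_Lfun1; exact: LfunP.
Qed.

Lemma innerC f g : inner f g = inner g f.
Proof. by apply: eq_Rintegral => x _; rewrite mulrC. Qed.

Lemma innerDl f g h : inner (f + g) h = inner f h + inner g h.
Proof.
rewrite /inner -RintegralD//; [|exact: integrable_mulL2..].
by apply: eq_Rintegral => x _; rewrite -mulrDl.
Qed.

Lemma innerZl (c : R) f g : inner (c *: f) g = c * inner f g.
Proof.
rewrite /inner -RintegralZl//; last exact: integrable_mulL2.
by apply: eq_Rintegral => x _; rewrite mulrA.
Qed.

Lemma innerDr f g h : inner h (f + g) = inner h f + inner h g.
Proof. by rewrite !(innerC h) innerDl. Qed.

Lemma innerZr (c : R) f g : inner f (c *: g) = c * inner f g.
Proof. by rewrite !(innerC f) innerZl. Qed.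

Lemma innerNl f g : inner (- f) g = - inner f g.
Proof. by rewrite -scaleN1r innerZl mulN1r. Qed.

Lemma innerNr f g : inner f (- g) = - inner f g.
Proof. by rewrite innerC innerNl innerC. Qed.

Lemma inner0l f : inner 0 f = 0.
Proof. by rewrite -(scale0r 0) innerZl mul0r. Qed.

Definition innerE := (innerDl, innerDr, innerZl, innerZr, innerNl, innerNr).

Lemma inner_ge0 f : 0 <= inner f f.
Proof. by apply: Rintegral_ge0 => x _; exact: sqr_ge0. Qed.

Lemma norm2_ge0 f : 0 <= norm2 f.
Proof. exact/fine_ge0/Lnorm_ge0. Qed.

Lemma norm2_sqr f : norm2 f ^+ 2 = inner f f.
Proof.
apply: EFin_inj; rewrite -powR_mulrn ?norm2_ge0// -poweR_EFin /norm2.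
rewrite finite_norm_fine powR_Lnorm// /inner /Rintegral fineK; last first.
  exact: integrable_fin_num (integrable_mulL2 _ _).
apply: eq_integral => x _ /=.
by rewrite powR_mulrn// -normrX ger0_norm ?sqr_ge0// expr2.
Qed.

Lemma norm2E f : norm2 f = Num.sqrt (inner f f).
Proof. by rewrite -norm2_sqr sqrtr_sqr ger0_norm// norm2_ge0. Qed.

Lemma norm2Z (c : R) f : norm2 (c *: f) = `|c| * norm2 f.
Proof.
by rewrite !norm2E innerZl innerZr mulrA -expr2 sqrtrM ?sqr_ge0// sqrtr_sqr.
Qed.

Lemma norm2_aeeq0 f : norm2 f = 0 -> ae_eq mu setT f (0 : X -> R).
Proof. by move=> /fine_Lnormr_eq0; apply: filterS => x /=. Qed.

End InnerProduct.

(** * Extremal pairs and the bias bound *)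

(** Let [t] tend to 0: for a tolerance [e], the choice [t = e / (|C| + e)] makes [t * C] at most
    [e]. This replaces every one-sided derivative below. *)
Lemma le_of_small_slope {R : realFieldType} (A B C : R) :
  (forall t : R, 0 < t <= 1 -> A <= B + t * C) -> A <= B.
Proof.
move=> AB; apply/ler_addgt0Pr => e e0.
have K0 : 0 < `|C| + e by rewrite ltr_wpDl.
have t01 : 0 < e / (`|C| + e) <= 1.
  by rewrite divr_gt0//= ler_pdivrMr// mul1r lerDr.
apply: (le_trans (AB _ t01)); rewrite lerD2l.
rewrite mulrAC ler_pdivrMr// ler_wpM2l ?(ltW e0)//.
by rewrite (le_trans (ler_norm _))// lerDl ltW.
Qed.

Section Extremal.
Context {d : measure_display} {X : measurableType d} {R : realType}.
Context {mu : {measure set X -> \bar R}}.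
Implicit Types f g : L2 mu.

Lemma convex_set_segment {S : set (L2 mu)} {f g} (t : R) :
  convex_set S -> S f -> S g -> 0 < t <= 1 -> S (f + t *: (g - f)).
Proof.
move=> cS Sf Sg /andP[t0 t1].
have t01 : Itv.spec (Itv.num_sem (R := R)) (Itv.Real `[0%Z, 1%Z]) t.
  by rewrite /= /Itv.num_sem/= in_itv/= ger0_real ?(ltW t0).
have := cS g f (Itv.mk t01); rewrite !inE => /(_ Sg Sf).
congr S; change (t *: g + (1 - t) *: f = f + t *: (g - f)).
by rewrite scalerBr scalerBl scale1r addrC -addrA (addrC (- _)).
Qed.

(** With [N] the left side and [e = norm2 (g - f)], [(N - e)^2 >= 0] gives
    [N <= (N^2 + e^2) / (2 e)], and [N^2] is a polynomial in [t]. The linear coefficient is the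
    derivative of the norm at [t = 0], obtained without differentiating a square root. *)
Lemma norm2_segment_le f g h (t : R) : 0 < norm2 (g - f) ->
  norm2 (g - (f + t *: (h - f))) <= norm2 (g - f) +
    t * ((2 * norm2 (g - f))^-1 * (t * inner (h - f) (h - f)
         - 2 * inner (g - f) (h - f))).
Proof.
move=> e0; set e := norm2 (g - f) in e0 *; set N := norm2 _.
have -> : e + t * ((2 * e)^-1 * (t * inner (h - f) (h - f)
            - 2 * inner (g - f) (h - f))) = (N ^+ 2 + e ^+ 2) / (2 * e).
  rewrite /N norm2_sqr.
  have -> : g - (f + t *: (h - f)) = (g - f) - t *: (h - f).
    by rewrite opprD addrA.
  rewrite {}/e in e0 *; move: (g - f) (h - f) e0 => v w e0.
  rewrite !innerE -(norm2_sqr v) (innerC w v).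
  by field; rewrite gt_eqF.
rewrite ler_pdivlMr ?mulr_gt0//.
have := sqr_ge0 (N - e); rewrite sqrrB => ?; lra.
Qed.

End Extremal.

Section Modulus.
Context {d : measure_display} {X : measurableType d} {R : realType}.
Context {mu : {measure set X -> \bar R}}.
Variables (D : set (L2 mu)) (T : L2 mu -> R).
Hypothesis linT : linear_functional_on D T.
Implicit Types (f g u : L2 mu) (F G : set (L2 mu)) (V c : R).

Lemma functional0 : T 0 = 0.
Proof.
case: linT => D0 _ lT _.
have := lT 1 _ _ D0 D0; rewrite scaler0 addr0 mul1r => /eqP.
by rewrite eq_sym -subr_eq0 addrK => /eqP.
Qed.

Lemma functionalZ c f : D f -> T (c *: f) = c * T f.
Proof.
case: linT => D0 _ lT _ Df.
by rewrite -[c *: f]addr0 lT// functional0 addr0.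
Qed.

Lemma functionalD f g : D f -> D g -> T (f + g) = T f + T g.
Proof.
by case: linT => _ _ lT _ Df Dg; rewrite -[f in LHS]scale1r lT// mul1r.
Qed.

Lemma domZ c f : D f -> D (c *: f).
Proof. by case: linT => D0 DD _ _ Df; rewrite -[c *: f]addr0; exact: DD. Qed.

Lemma domD f g : D f -> D g -> D (f + g).
Proof. by case: linT => D0 DD _ _ Df Dg; rewrite -[f]scale1r; exact: DD. Qed.

Lemma functional_segment f g c : D f -> D g ->
  T (f + c *: (g - f)) = T f + c * (T g - T f).
Proof.
move=> Df Dg; rewrite -[X in g + X]scaleN1r.
have DNf := domZ (-1) Df.
rewrite functionalD//; last by apply/domZ/domD.
by rewrite functionalZ; [rewrite functionalD// functionalZ// mulN1r|exact: domD].
Qed.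

Lemma functional_eq_norm2 f g : D f -> D g -> norm2 (g - f) = 0 -> T f = T g.
Proof.
case: linT => _ _ _ aeT Df Dg /norm2_aeeq0 gf0; apply: aeT => //.
apply: filterS gf0 => x /(_ I) /= /eqP; rewrite subr_eq0 => /eqP gfx _.
by rewrite gfx.
Qed.

(* Differentiate [T f + c * norm2 (g0 - f)] at its minimiser [f0] along the
   segment towards [f]. *)
Lemma variational_inequality (S : set (L2 mu)) c f0 g0 f : 0 <= c ->
  S `<=` D -> convex_set S -> S f0 -> 0 < norm2 (g0 - f0) ->
  (forall f, S f -> T f0 + c * norm2 (g0 - f0) <= T f + c * norm2 (g0 - f)) ->
  S f -> c * inner (direction (norm2 (g0 - f0)) f0 g0) (f - f0) <= T f - T f0.
Proof.
move=> c0 SD cS Sf0 e0 min0 Sf; set e := norm2 _ in e0 *.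
(* The slope is the second-order coefficient of the bound on the distance: minimality along the
   segment, divided by [t], leaves exactly [t] times this error. *)
apply: (@le_of_small_slope _ _ _ (c * ((2 * e)^-1 * inner (f - f0) (f - f0)))).
move=> t t01; have /andP[t0 _] := t01.
have := min0 _ (convex_set_segment cS Sf0 Sf t01).
rewrite functional_segment; [|exact: SD..].
have := ler_wpM2l c0 (norm2_segment_le f t e0).
rewrite -/e /direction innerZl; clearbody e; set N := norm2 _.
move: (inner (g0 - f0) _) (inner (f - f0) _) N => p q N le1 le2.
have : t * (c * (e^-1 * p)) <= t * (T f - T f0 + t * (c * ((2 * e)^-1 * q))).
  have -> : t * (c * (e^-1 * p)) = c * e + t * (t * (c * ((2 * e)^-1 * q)))
      - c * (e + t * ((2 * e)^-1 * (t * q - 2 * p))).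
    by field; exact: lt0r_neq0.
  by lra.
by rewrite ler_pM2l.
Qed.

End Modulus.

(** * The bias bound as a supremum over pairs, and its extremal pairs *)

Section BiasBound.
Context {d : measure_display} {X : measurableType d} {R : realType}.
Context {mu : {measure set X -> \bar R}}.
Variables (n : R) (T : L2 mu -> R).
Implicit Types (f g u : L2 mu) (F G : set (L2 mu)) (V b : R).

(** The penalized objective of a single pair, charged at its own distance. Its supremum over [F] and
    [G] is twice the bias bound, so the modulus can be avoided from here on. *)
Definition gap V f g : R := T g - T f - Num.sqrt (n * V) * norm2 (g - f).

Lemma gap_le_penalized V F G f g : F f -> G g ->
  ((gap V f g)%:E <= penalized n T V F G (norm2 (g - f)%R))%E.
Proof.
move=> Ff Gg; rewrite /penalized /gap EFinB leeB//.
by apply: ereal_sup_ubound; exists f, g.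
Qed.

Lemma bias_bound_leP V F G b :
  (bias_bound n T V F G <= b%:E)%E <->
  forall f g, F f -> G g -> gap V f g <= 2 * b.
Proof.
have half (x : \bar R) : ((2^-1%:E * x <= b%:E) = (x <= (2 * b)%:E))%E.
  by rewrite muleC lee_pdivrMr// -EFinM mulrC.
rewrite /bias_bound half; split => [Bb f g Ff Gg|gapb].
  (* The supremum in [bias_bound] runs over [e > 0], whereas a pair may be at distance 0. Each pair
     is therefore tested at [norm2 (g - f) + t], and [t] tends to 0. *)
  apply: (@le_of_small_slope _ _ _ (Num.sqrt (n * V))) => t /andP[t0 _].
  rewrite -lerBlDr -lee_fin; apply: le_trans Bb.
  apply: (@le_trans _ _ (penalized n T V F G (norm2 (g - f) + t))).
    rewrite /penalized /gap -addrA -opprD (mulrC t) -mulrDr EFinB leeB//.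
    by apply: ereal_sup_ubound; exists f, g; split => //; rewrite lerDl ltW.
  apply: ereal_sup_ubound; exists (norm2 (g - f) + t) => //=.
  by rewrite in_itv/= andbT ltr_wpDl// norm2_ge0.
apply: ge_ereal_sup => _ [e /= /[!in_itv]/= /andP[e0 _] <-].
rewrite /penalized leeBlDr// -EFinD; apply: ge_ereal_sup => _ [f [g [Ff Gg fge ->]]].
rewrite lee_fin -lerBlDr; apply: le_trans (gapb f g Ff Gg).
by rewrite lerB// ler_wpM2l// sqrtr_ge0.
Qed.

Lemma bias_bound_gt0P V F G :
  (0 < bias_bound n T V F G)%E <->
  exists f g, [/\ F f, G g & 0 < gap V f g].
Proof.
rewrite ltNge; split => [/negP B0|[f [g [Ff Gg gap0]]]].
  apply: contrapT => nex; apply: B0; apply/bias_bound_leP => f g Ff Gg.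
  by rewrite mulr0 leNgt; apply/negP => gap0; apply: nex; exists f, g.
by apply/negP => /bias_bound_leP/(_ f g Ff Gg); rewrite mulr0 leNgt gap0.
Qed.

Lemma gap_anti V V' f g : 0 < n -> V <= V' -> gap V' f g <= gap V f g.
Proof.
move=> n0 VV'; rewrite lerB// ler_wpM2r ?norm2_ge0// ler_wsqrtr//.
by rewrite ler_pM2l.
Qed.

Section ExtremalPair.
Variable D : set (L2 mu).
Hypothesis linT : linear_functional_on D T.
Variables (V e : R) (F G : set (L2 mu)) (f0 g0 : L2 mu).
Hypotheses (FD : F `<=` D) (GD : G `<=` D) (Ff0 : F f0) (Gg0 : G g0).
Hypothesis epsE : is_epsilon n T V F G e%:E.
Hypotheses (normE : norm2 (g0 - f0) = e)
  (modE : (T g0 - T f0)%:E = omega T e F G).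

(** Any gap is at most the penalized modulus at its own distance, hence at most the maximum, which
    is reached at [e]; there the pair [(f0, g0)] realizes the modulus. *)
Lemma extremal_gap_max f g : F f -> G g -> gap V f g <= gap V f0 g0.
Proof.
move=> Ff Gg; rewrite -lee_fin.
apply: (le_trans (gap_le_penalized V Ff Gg)).
case: epsE => _ /(_ (norm2 (g - f)) (norm2_ge0 _)) + _ => /le_trans; apply.
by rewrite /penalized /gap EFinB normE modE.
Qed.

(** At distance 0 the two values of [T] would agree and the maximal gap would be 0, whereas a
    positive bias bound provides a pair with positive gap. Hence the division by [e] in [direction]
    is a genuine one. *)
Lemma extremal_norm2_gt0 : (0 < bias_bound n T V F G)%E -> 0 < norm2 (g0 - f0).
Proof.
move=> /bias_bound_gt0P[f [g [Ff Gg gap0]]].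
rewrite lt_neqAle norm2_ge0 andbT; apply/eqP => /esym norm0.
have := lt_le_trans gap0 (extremal_gap_max Ff Gg).
rewrite /gap norm0 mulr0 subr0 (functional_eq_norm2 linT (FD Ff0) (GD Gg0))//.
by rewrite subrr ltxx.
Qed.

Hypotheses (cF : convex_set F) (cG : convex_set G).
Hypothesis B_gt0 : (0 < bias_bound n T V F G)%E.

Let u := direction e f0 g0.
Let a := Defs.constant n T V e f0 g0.
Let c := Num.sqrt (n * V).

(** Recentres the affine functional at [f0]. The midpoint in the definition of the constant
    contributes [e / 2], because [<u, g0 - f0> = e]. *)
Let constantE f : a + c * inner u f =
  2^-1 * (T f0 + T g0) + c * (inner u (f - f0) - 2^-1 * e).
Proof.
have e0 := extremal_norm2_gt0 B_gt0.
have Df0 := FD Ff0; have Dg0 := GD Gg0.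
have ue : inner u (g0 - f0) = e.
  rewrite /u /direction innerZl -norm2_sqr normE; field.
  by rewrite -normE gt_eqF.
rewrite /a /Defs.constant -/u -/c (functionalZ linT)//; last exact: (domD linT).
rewrite (functionalD linT)//.
move: (u) ue => v; rewrite !innerE => ve.
have -> : inner v g0 = e + inner v f0 by lra.
lra.
Qed.

(** With [g0] fixed, maximality of the gap says that [f0] minimizes [T f + c * norm2 (g0 - f)] over
    [F]. The variational inequality then gives [c * <u, f - f0> <= T f - T f0], which is inserted
    into [constantE]. *)
Lemma extremal_bias_upper f : F f -> a + c * inner u f - T f <= 2^-1 * gap V f0 g0.
Proof.
move=> Ff; rewrite constantE.
have := @variational_inequality _ _ _ _ _ _ linT F c f0 g0 f (sqrtr_ge0 _) FD cF Ff0
  (extremal_norm2_gt0 B_gt0).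
rewrite normE -/u => /(_ _ Ff) H.
have {H} : c * inner u (f - f0) <= T f - T f0.
  apply: H => h Fh; have := extremal_gap_max Fh Gg0.
  rewrite /gap normE -/c; clearbody c u; lra.
rewrite /gap normE -/c; clearbody c u; lra.
Qed.

(** The mirror image of the upper bound: the variational inequality is applied to [- T] on [G] with
    [f0] and [g0] exchanged, which turns [u] into [- u]. *)
Lemma extremal_bias_lower g : G g ->
  - (2^-1 * gap V f0 g0) <= a + c * inner u g - T g.
Proof.
move=> Gg; rewrite constantE.
have linN : linear_functional_on D (fun f => - T f).
  case: linT => D0 DD lT aeT; split => // [k f h Df Dh|f h Df Dh fh].
    by rewrite lT// opprD mulrN.
  by rewrite (aeT f h).
have normC f h : norm2 (f - h) = norm2 (h - f).
  by rewrite -[f - h]opprB norm2E innerNl innerNr opprK -norm2E.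
have := @variational_inequality _ _ _ _ _ _ linN G c g0 f0 g (sqrtr_ge0 _) GD cG Gg0.
rewrite normC => /(_ (extremal_norm2_gt0 B_gt0)).
rewrite normE => /(_ _ Gg) H.
have ue : inner u (g0 - f0) = e.
  rewrite /u /direction innerZl -norm2_sqr normE; field.
  by rewrite -normE gt_eqF// extremal_norm2_gt0.
have uN : direction e g0 f0 = - u.
  by rewrite /u /direction -scalerN opprB.
have {}H : c * inner (- u) (g - g0) <= - T g - - T g0.
  rewrite -uN; apply: H => h Gh; have := extremal_gap_max Ff0 Gh.
  rewrite (normC f0 h) /gap normE -/c; clearbody c u; lra.
rewrite innerNl (_ : inner u (g - g0) = inner u (g - f0) - e) in H; last first.
  by move: (u) ue => v; rewrite !innerE; lra.
rewrite -subr_ge0 in H; rewrite -subr_ge0 /gap normE -/c.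
move: (inner u _) (T f0) (T g0) (T g) (c) H => x tf0 tg0 tg k H.
by apply: (le_trans H); rewrite le_eqVlt; apply/orP; left; apply/eqP; field.
Qed.

End ExtremalPair.
End BiasBound.

(** * Passage to the limit *)

Section Limit.
Context {d : measure_display} {X : measurableType d} {R : realType}.
Context {mu : {measure set X -> \bar R}}.
Variables (n : R) (T : L2 mu -> R).
Hypothesis n0 : 0 < n.
Implicit Types (f g u : L2 mu) (F G : set (L2 mu)) (V b : R).

Lemma near_ball_part F (l : nat -> nat) f : F f -> l m @[m --> \oo] --> \oo ->
  \forall m \near \oo, ball_part F (l m) f.
Proof.
move=> Ff loo.
have : \forall m \near \oo, norm2 f <= (l m)%:R.
  exact: loo _ (nbhs_infty_ger (norm2 f)).
by apply: filterS => m /= ?; split.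
Qed.

(** Positivity is witnessed by a single pair, which lies in all sufficiently large balls. *)
Lemma near_bias_bound_part_gt0 V F G (l : nat -> nat) :
  (0 < bias_bound n T V F G)%E -> l m @[m --> \oo] --> \oo ->
  \forall m \near \oo, (0 < bias_bound_part n T V F G (l m))%E.
Proof.
move=> /bias_bound_gt0P[f [g [Ff Gg gap0]]] loo.
apply: filterS2 (near_ball_part Ff loo) (near_ball_part Gg loo) => m Fmf Gmg.
by apply/bias_bound_gt0P; exists f, g.
Qed.

Lemma bias_bound_part_le V V' F G m b : V <= V' ->
  (bias_bound n T V F G <= b%:E)%E -> (bias_bound_part n T V' F G m <= b%:E)%E.
Proof.
move=> VV' /bias_bound_leP B; apply/bias_bound_leP => f g [Ff _] [Gg _].
by apply: le_trans (B f g Ff Gg); exact: gap_anti.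
Qed.

Lemma bias_bound_gap0 V F G f g : bias_bound n T V F G = 0%E -> F f -> G g ->
  gap n T V f g <= 0.
Proof.
move=> /eqP; rewrite eq_le => /andP[/bias_bound_leP B0 _] Ff Gg.
by rewrite -(mulr0 2) B0.
Qed.

(** Take [V' < V] and a pair with positive gap at [V']. If [Vs m <= V'], its gap at [Vs m] is at
    least as large; but once the pair lies in the ball of radius [m], that gap is at most [2 / m].
    So [Vs m] eventually exceeds every such [V']. *)
Lemma case2a_cvg V F G m0 (Vs : nat -> R) :
  case2 n T V F G ->
  (forall m, (m0 <= m)%N -> 0 <= Vs m < V /\
    (bias_bound_part n T (Vs m) F G m <= (m%:R^-1)%:E)%E) ->
  Vs m @[m --> \oo] --> V.
Proof.
move=> [_ Bpos] VsP; apply/cvgrPdist_le => e e0.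
have V0 : 0 < V by have [/andP[+ +] _] := VsP _ (leqnn m0) => /le_lt_trans/[apply].
(* The maximum with 0 keeps [V'] in the range where Case 2 guarantees a positive bias bound. *)
pose V' := Num.max 0 (V - e).
have V'V : 0 <= V' < V by rewrite le_max lexx gt_max V0 ltrBlDr ltrDl e0.
have /bias_bound_gt0P[f [g [Ff Gg gap0]]] := Bpos _ V'V.
near=> m.
have m0m : (m0 <= m)%N by near: m; exact: nbhs_infty_ge.
have [/andP[Vs0 VsV] /bias_bound_leP/(_ f g) B] := VsP _ m0m.
rewrite ger0_norm ?subr_ge0 ?(ltW VsV)// lerBlDr addrC -lerBlDr.
rewrite leNgt; apply/negP => VsV'.
have : Vs m <= V' by rewrite le_max (ltW VsV') orbT.
move=> /(gap_anti T f g n0); rewrite leNgt => /negP; apply.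
apply: (@le_lt_trans _ _ (2 * m%:R^-1)).
  apply: B.
    by near: m; apply: near_ball_part => //; exact: cvg_id.
  by near: m; apply: near_ball_part => //; exact: cvg_id.
have lt : 2 / gap n T V' f g < m%:R by near: m; exact: nbhs_infty_gtr.
have mpos : 0 < m%:R :> R by rewrite (le_lt_trans _ lt)// divr_ge0// ltW.
by move: lt; rewrite ltr_pdivrMr// => lt; rewrite ltr_pdivrMr// mulrC.
Unshelve. all: by end_near. Qed.

(** For a fixed pair the gap is affine in [sqrt (n V)]. At [Vs m] it is thus a convex combination of
    the gap at [Vs m0], bounded by [2 M], and the gap at [V], which is nonpositive. The weight of
    the former vanishes as [Vs m] tends to [V], uniformly over all pairs. *)
Lemma case2b_bias_bound_cvg0 V F G m0 (Vs : nat -> R) (e : R) : 0 < e ->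
  bias_bound n T V F G = 0%E ->
  (forall m, (m0 <= m)%N -> 0 <= Vs m < V /\ (bias_bound n T (Vs m) F G < +oo)%E) ->
  (forall m, (m0 <= m)%N -> Vs m0 <= Vs m) ->
  Vs m @[m --> \oo] --> V ->
  \forall m \near \oo, (bias_bound n T (Vs m) F G <= e%:E)%E.
Proof.
move=> e0 B0 VsP Vs_ge cV.
have [/andP[Vs0 VsV] Bfin] := VsP _ (leqnn m0).
have [M [M0 BM]] : exists M : R, 0 < M /\ (bias_bound n T (Vs m0) F G <= M%:E)%E.
  move: Bfin; case: (bias_bound _ _ _ _ _) => [r _|//|_].
    by exists (`|r| + 1); rewrite ltr_wpDl// lee_fin ler_wpDr// ler_norm.
  by exists 1; rewrite leNye.
move: BM => /bias_bound_leP BM.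
pose c (V : R) := Num.sqrt (n * V).
have cc : c (Vs m) @[m --> \oo] --> c V.
  apply: (@cvg_comp _ _ _ (fun m => n * Vs m) Num.sqrt _ (nbhs (n * V))).
    exact: cvgMr.
  exact: sqrt_continuous.
have K0 : 0 < c V - c (Vs m0).
  rewrite subr_gt0 /c ltr_sqrt ?mulr_gt0//; last exact: le_lt_trans VsV.
  by rewrite ltr_pM2l.
(* This tolerance on [c V - c (Vs m)] makes the weight of the gap at [Vs m0] at most [e / M], so
   that its contribution is at most [2 e]. *)
have d0 : 0 < e * (c V - c (Vs m0)) / M by rewrite divr_gt0// mulr_gt0.
near=> m.
have m0m : (m0 <= m)%N by near: m; exact: nbhs_infty_ge.
have cm : c V - c (Vs m) <= e * (c V - c (Vs m0)) / M.
  rewrite (le_trans (ler_norm _))//.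
  by near: m; move/cvgrPdist_le : cc; apply.
have cVm : c (Vs m) <= c V.
  by rewrite ler_wsqrtr// ler_pM2l// ltW//; have [/andP[_ ]] := VsP _ m0m.
have cm0 : c (Vs m0) <= c (Vs m) by rewrite ler_wsqrtr// ler_pM2l// Vs_ge.
apply/bias_bound_leP => f g Ff Gg.
have gap1 := BM _ _ Ff Gg.
have gap2 := bias_bound_gap0 B0 Ff Gg.
have -> : gap n T (Vs m) f g = ((c V - c (Vs m)) * gap n T (Vs m0) f g
    + (c (Vs m) - c (Vs m0)) * gap n T V f g) / (c V - c (Vs m0)).
  by rewrite /gap -/(c _) -/(c _) -/(c _); field; rewrite gt_eqF.
rewrite ler_pdivrMr//.
apply: (@le_trans _ _ ((c V - c (Vs m)) * (2 * M))).
  rewrite -[leRHS]addr0 lerD//; first by rewrite ler_wpM2l// subr_ge0.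
  by rewrite mulr_ge0_le0// subr_ge0.
move: cm; rewrite ler_pdivlMr//; lra.
Unshelve. all: by end_near. Qed.

(** Collects what the limit argument needs, uniformly in the four cases. In Case 1, [Vs m >= V]
    bounds the truncated bias bounds by [b]. In Case 2, [b = 0], and they are at most [1 / m] in
    2(a), or controlled by the untruncated bounds at [Vs m] in 2(b). *)
Lemma admissible_choice_cvg V F G m0 (Vs : nat -> R) (l : nat -> nat) :
  admissible_choice n T V F G m0 Vs l ->
  exists b : R,
  [/\ bias_bound n T V F G = b%:E,
      Vs m @[m --> \oo] --> V,
      l m @[m --> \oo] --> \oo,
      \forall m \near \oo, (0 < bias_bound_part n T (Vs m) F G (l m))%E &
      forall e : R, 0 < e -> \forall m \near \oo,
        (bias_bound_part n T (Vs m) F G (l m) <= (b + e)%:E)%E].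
Proof.
have eqV V' : (forall m, (m0 <= m)%N -> Vs m = V') -> Vs m @[m --> \oo] --> V'.
  move=> VsV; apply: (@cvg_near_cst _ _ _ _ _ _ _).
  by near=> m; apply: VsV; near: m; exact: nbhs_infty_ge.
have eql : (forall m, (m0 <= m)%N -> l m = m) -> l m @[m --> \oo] --> \oo.
  move=> lm; apply: (@cvg_trans _ (m @[m --> \oo])); last exact: cvg_id.
  by apply: near_eq_cvg; near=> m; rewrite lm//; near: m; exact: nbhs_infty_ge.
have case1_fin : case1 n T V F G -> exists2 b : R, bias_bound n T V F G = b%:E &
    (0 < bias_bound n T V F G)%E.
  rewrite /case1; case: (bias_bound _ _ _ _ _) => [r /andP[]|/andP[]|/andP[]]//.
  by exists r.
case.
- move=> [[/case1_fin[b Bb B0] _] VsP]; exists b.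
  have loo : l m @[m --> \oo] --> \oo by apply: eql => m /VsP[].
  split => //; first by apply: eqV => m /VsP[].
    near=> m; have [] // := VsP m; first by near: m; exact: nbhs_infty_ge.
    move=> -> _; near: m; exact: near_bias_bound_part_gt0.
  move=> e e0; near=> m; apply: (@bias_bound_part_le V).
    by have [] // := VsP m; [near: m; exact: nbhs_infty_ge|move=> ->].
  by rewrite Bb lee_fin lerDl ltW.
- move=> [[/case1_fin[b Bb B0] _] [VsP _ cV loo]]; exists b; split => //.
    by near=> m; have [] // := VsP m; near: m; exact: nbhs_infty_ge.
  move=> e e0; near=> m; apply: (@bias_bound_part_le V).
    by have [] // := VsP m; [near: m; exact: nbhs_infty_ge|move=> /ltW].
  by rewrite Bb lee_fin lerDl ltW.
- move=> [[c2 _] VsP]; exists 0; split.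
  + by case: c2.
  + apply: (case2a_cvg c2 (m0 := m0)) => m /VsP[VsV lm /andP[_]].
    by rewrite lm.
  + by apply: eql => m /VsP[].
  + near=> m; have [] // := VsP m; first by near: m; exact: nbhs_infty_ge.
    by move=> _ _ /andP[].
  + move=> e e0; near=> m.
    have [] // := VsP m; first by near: m; exact: nbhs_infty_ge.
    move=> _ _ /andP[_ /le_trans]; apply; rewrite add0r lee_fin.
    have lt : e^-1 < m%:R by near: m; exact: nbhs_infty_gtr.
    by rewrite invf_ple ?posrE ?(ltW lt)// (lt_trans _ lt)// invr_gt0.
- move=> [[[B0 _] _] [VsP Vsl cV loo]]; exists 0; split => //.
    near=> m; have [] // := VsP m; first by near: m; exact: nbhs_infty_ge.
    by move=> _ [/andP[]].
  move=> e e0; have := @case2b_bias_bound_cvg0 V F G m0 Vs e e0 B0.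
  move=> /(_ _ _ cV) H.
  near=> m; rewrite add0r; apply: (@bias_bound_part_le (Vs m)) => //.
  near: m; apply: H => m mm0.
    by have [? []] := VsP m mm0.
  by have [] := Vsl _ _ (leqnn _) mm0.
Unshelve. all: by end_near. Qed.

End Limit.

Lemma increasing_cvg_infty (phi : nat -> nat) :
  {homo phi : i j / (i < j)%N} -> phi k @[k --> \oo] --> \oo.
Proof.
move=> phiP; apply/cvgnyPge => A.
have geid k : (k <= phi k)%N by elim: k => // k /leq_ltn_trans; apply; exact: phiP.
by near=> k; apply: leq_trans (geid k); near: k; exact: nbhs_infty_ge.
Unshelve. all: by end_near. Qed.

(** * Bias of the limit pair *)

Section LimitPair.
Context {d : measure_display} {X : measurableType d} {R : realType}.
Context {mu : {measure set X -> \bar R}}.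
Variables (n : R) (D : set (L2 mu)) (T : L2 mu -> R).
Hypotheses (n0 : 0 < n) (linT : linear_functional_on D T).
Implicit Types (f g u : L2 mu) (F G : set (L2 mu)).

Lemma ball_part_convex F m : convex_set F -> convex_set (ball_part F m).
Proof.
move=> cF f g t; rewrite !inE => -[Ff fm] [Gg gm]; split.
  by have := cF f g t; rewrite !inE; apply.
change (norm2 (t%:num *: f + (1 - t%:num) *: g) <= m%:R).
apply: (le_trans (ler_LnormD _ _)).
rewrite -!/(norm2 _) !norm2Z !ger0_norm ?subr_ge0//.
rewrite [leRHS](_ : _ = t%:num * m%:R + (1 - t%:num) * m%:R); last by ring.
by rewrite lerD// ler_wpM2l// subr_ge0.
Qed.

Lemma weak_limit_norm (s : nat -> L2 mu) u :
  (\forall k \near \oo, inner (s k) (s k) <= 1) -> weakly_cvg s u ->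
  inner u u <= 1.
Proof.
move=> s1 su.
(* Expanding [0 <= <s k - u, s k - u>] gives [<s k, u> <= (1 + <u, u>) / 2], a bound that is linear
   in [s k] and so passes to the weak limit. *)
suff : inner u u <= 2^-1 * (1 + inner u u) by lra.
apply: (cvgr_to_le (su u)); apply: filterS s1 => k sk.
have := inner_ge0 (s k - u); rewrite !innerE (innerC u (s k)); lra.
Qed.

Lemma limit_pair_bias V F G u a :
  F `<=` D -> G `<=` D -> convex_set F -> convex_set G ->
  limit_pair n T V F G u a ->
  [/\ inner u u <= 1,
      forall f, F f ->
        ((a + Num.sqrt (n * V) * inner u f - T f)%:E <= bias_bound n T V F G)%E &
      forall g, G g -> (- bias_bound n T V F G <=
        (a + Num.sqrt (n * V) * inner u g - T g)%:E)%E].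
Proof.
move=> FD GD cF cG [m0 [Vs [l [eps [fs [gs [phi]]]]]]].
move=> [/(admissible_choice_cvg n0)[b [-> cV loo Bpos Ble]] epsP extP phi_incr [uP aP]].
have phi_oo := increasing_cvg_infty phi_incr.
have sub (P : nat -> Prop) : (\forall m \near \oo, P m) ->
  \forall k \near \oo, P (phi k) by exact: phi_oo.
pose c m := Num.sqrt (n * Vs m).
pose us m := direction (eps m) (fs m) (gs m).
have cc : c (phi k) @[k --> \oo] --> Num.sqrt (n * V).
  apply: (@cvg_comp _ _ _ (fun k => n * Vs (phi k)) Num.sqrt _ (nbhs (n * V))).
    by apply: cvgMr; exact: cvg_comp phi_oo cV.
  exact: sqrt_continuous.
have BD F' m : F' `<=` D -> ball_part F' m `<=` D by move=> F'D f [/F'D].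
have near_ge : \forall m \near \oo, (m0 <= m)%N by exact: nbhs_infty_ge.
(* For a fixed [h] only the number [<u_m, h>] varies with the direction, so weak convergence
   suffices. *)
have biascvg h : Defs.constant n T (Vs (phi k)) (eps (phi k)) (fs (phi k)) (gs (phi k))
    + c (phi k) * inner (us (phi k)) h - T h @[k --> \oo] -->
    a + Num.sqrt (n * V) * inner u h - T h.
  by apply: cvgB; [apply: cvgD => //; apply: cvgM => //; exact: uP|exact: cvg_cst].
have gap_le (e : R) : 0 < e -> \forall m \near \oo,
    2^-1 * gap n T (Vs m) (fs m) (gs m) <= b + e.
  move=> e0; apply: filterS2 near_ge (Ble _ e0) => m mm0 /bias_bound_leP B.
  have [Ff Gg _ _] := extP m mm0.
  by have := B _ _ Ff Gg; lra.
have nearB : \forall m \near \oo, (m0 <= m)%N /\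
    (0 < bias_bound_part n T (Vs m) F G (l m))%E.
  by apply: filterS2 near_ge Bpos => m.
split.
- apply: weak_limit_norm uP; apply: (sub (fun m => inner (us m) (us m) <= 1)).
  apply: filterS2 near_ge Bpos => m mm0 B0.
  have [Ff Gg nE mE] := extP m mm0.
  have e0 := extremal_norm2_gt0 linT (BD _ _ FD) (BD _ _ GD) Ff Gg (epsP m mm0) nE mE B0.
  rewrite /us /direction innerZl innerZr -norm2_sqr nE.
  rewrite nE in e0.
  by rewrite le_eqVlt; apply/orP; left; apply/eqP; field; rewrite gt_eqF.
- move=> f Ff; rewrite lee_fin; apply/ler_addgt0Pr => e e0.
  apply: (cvgr_to_le (biascvg f)).
  apply: (sub (fun m => Defs.constant n T (Vs m) (eps m) (fs m) (gs m)
    + c m * inner (us m) f - T f <= b + e)).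
  apply: filterS3 nearB (gap_le _ e0) (near_ball_part Ff loo) => m [mm0 B0] gapm fm.
  have [Ffm Ggm nE mE] := extP m mm0.
  apply: le_trans (_ : 2^-1 * gap n T (Vs m) (fs m) (gs m) <= _) => //.
  apply: (extremal_bias_upper linT (BD _ _ FD) (BD _ _ GD) Ffm Ggm (epsP m mm0) nE mE) => //.
  exact: ball_part_convex.
- move=> g Gg; rewrite -EFinN lee_fin; apply/ler_addgt0Pr => e e0; rewrite -lerBlDr.
  apply: (cvgr_to_ge (biascvg g)).
  apply: (sub (fun m => - b - e <= Defs.constant n T (Vs m) (eps m) (fs m) (gs m)
    + c m * inner (us m) g - T g)).
  apply: filterS3 nearB (gap_le _ e0) (near_ball_part Gg loo) => m [mm0 B0] gapm gm.
  have [Ffm Ggm nE mE] := extP m mm0.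
  apply: (@le_trans _ _ (- (2^-1 * gap n T (Vs m) (fs m) (gs m)))).
    by rewrite -opprD lerN2.
  apply: (extremal_bias_lower linT (BD _ _ FD) (BD _ _ GD) Ffm Ggm (epsP m mm0) nE mE) => //.
  exact: ball_part_convex.
Qed.

End LimitPair.

(** * Mean-square limits *)

Section L2Limits.
Context {d : measure_display} {X : measurableType d} {R : realType}.
Context {mu : {measure set X -> \bar R}}.
Implicit Types f g h : L2 mu.

Lemma norm2D f g : norm2 (f + g) <= norm2 f + norm2 g.
Proof. exact: ler_LnormD. Qed.

Lemma norm2N f : norm2 (- f) = norm2 f.
Proof. by rewrite -scaleN1r norm2Z normrN1 mul1r. Qed.

Lemma norm2B f g : norm2 (f - g) = norm2 (g - f).
Proof. by rewrite -norm2N opprB. Qed.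

Lemma cauchy_schwarz f g : `|inner f g| <= norm2 f * norm2 g.
Proof.
have [g0|g0] := eqVneq (norm2 g) 0; last first.
  have {}g0 : 0 < norm2 g by rewrite lt_neqAle eq_sym g0 norm2_ge0.
  rewrite -ler_sqr ?nnegrE ?mulr_ge0 ?norm2_ge0// real_normK ?num_real// exprMn !norm2_sqr.
  have gg : 0 < inner g g by rewrite -norm2_sqr exprn_gt0.
  have := inner_ge0 (inner g g *: f - inner f g *: g).
  rewrite !innerE (innerC g f) => H.
  have {H} : 0 <= inner g g * (inner f f * inner g g - inner f g ^+ 2) by lra.
  by rewrite pmulr_rge0// subr_ge0.
rewrite g0 mulr0 normr_le0; apply/eqP.
(* When [norm2 g = 0], the quadratic [<f - c g, f - c g>] degenerates to an affine function of [c].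
   Being nonnegative for every [c], it must have slope 0. *)
suff le0 (c : R) : c * (2 * inner f g) <= inner f f.
  apply/eqP; rewrite -[_ == 0]orFb -(_ : (2 : R) == 0 = false)//; last first.
    by rewrite pnatr_eq0.
  rewrite -mulf_eq0; apply/negP => /negP fg0.
  have := le0 ((inner f f + 1) / (2 * inner f g)).
  by rewrite divfK// gerDl ler10.
have := inner_ge0 (f - c *: g); rewrite !innerE (innerC g f).
have -> : inner g g = 0 by rewrite -norm2_sqr g0 expr0n.
lra.
Qed.

Lemma L2_sumE (m : nat) (c : nat -> R) (e : nat -> L2 mu) (x : X) :
  (\sum_(i < m) c i *: e i) x = \sum_(i < m) c i * e i x.
Proof. by elim: m => [|m IH]; rewrite ?big_ord0// !big_ord_recr/= -IH. Qed.

Lemma inner_suml (m : nat) (c : nat -> R) (e : nat -> L2 mu) f :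
  inner (\sum_(i < m) c i *: e i) f = \sum_(i < m) c i * inner (e i) f.
Proof.
elim: m => [|m IH]; first by rewrite !big_ord0 inner0l.
by rewrite !big_ord_recr/= innerDl innerZl IH.
Qed.

Lemma inner_sum_orthogonal (m : nat) (c : nat -> R) (e : nat -> L2 mu) :
  (forall i j, (i < j < m)%N -> inner (e i) (e j) = 0) ->
  inner (\sum_(i < m) c i *: e i) (\sum_(i < m) c i *: e i) =
  \sum_(i < m) c i ^+ 2 * inner (e i) (e i).
Proof.
elim: m => [|m IH] orth; first by rewrite !big_ord0 inner0l.
rewrite !big_ord_recr/= !innerDl !innerDr IH; last first.
  by move=> i j /andP[ij jm]; apply: orth; rewrite ij ltnS ltnW.
have S0 : inner (\sum_(i < m) c i *: e i) (e m) = 0.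
  rewrite inner_suml big1// => i _.
  by rewrite orth ?mulr0// ltn_ord ltnSn.
rewrite (innerC (c m *: e m) (\sum_(_ < _) _)) !innerZr S0 innerZl.
by rewrite mulr0 addr0 add0r mulrA expr2.
Qed.

Lemma L2_mem (f : X -> R) : measurable_fun setT f ->
  (\int[mu]_x (f x ^+ 2)%:E < +oo)%E -> f \in Lfun mu 2%:E.
Proof.
move=> mf foo; rewrite inE; apply/andP; split; rewrite inE//=.
rewrite /finite_norm unlock /Lnorm poweR_lty//.
by under eq_integral => x _ do rewrite /= powR_mulrn// -normrX ger0_norm ?sqr_ge0//.
Qed.

Lemma norm2_sqr_integral f : ((norm2 f ^+ 2)%:E = \int[mu]_x (f x ^+ 2)%:E)%E.
Proof.
rewrite norm2_sqr /inner /Rintegral fineK; last first.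
  exact: integrable_fin_num (integrable_mulL2 _ _).
by apply: eq_integral => x _; rewrite expr2.
Qed.

Lemma cvg_norm2_0 (s : nat -> L2 mu) (I : nat -> \bar R) :
  (\forall k \near \oo, ((norm2 (s k) ^+ 2)%:E <= I k)%E) ->
  I k @[k --> \oo] --> 0%E -> norm2 (s k) @[k --> \oo] --> (0 : R).
Proof.
move=> sI I0; apply/cvgrPdist_lt => e e0.
have Ilt : \forall k \near \oo, (I k < (e ^+ 2)%:E)%E.
  have e20 : 0 < e ^+ 2 by rewrite exprn_gt0.
  exact: I0 _ (@nbhs_open_ereal_lt _ 0 (fun=> e ^+ 2) e20).
apply: filterS2 sI Ilt => k s2 I2.
rewrite sub0r normrN ger0_norm ?norm2_ge0// -ltr_sqr ?nnegrE ?norm2_ge0 ?ltW//.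
by rewrite -lte_fin (le_lt_trans s2).
Qed.

Lemma cvg_norm2 (s : nat -> L2 mu) f : norm2 (s k - f) @[k --> \oo] --> (0 : R) ->
  norm2 (s k) @[k --> \oo] --> norm2 f.
Proof.
move=> /cvgrPdist_le s0; apply/cvgrPdist_le => e /s0; apply: filterS => k.
rewrite sub0r normrN ger0_norm ?norm2_ge0//; apply: le_trans.
have := norm2D (s k - f) f; have := norm2D (f - s k) (s k).
by rewrite !subrK (norm2B f) ler_norml => *; apply/andP; split; lra.
Qed.

Lemma cvg_inner h (s : nat -> L2 mu) f : norm2 (s k - f) @[k --> \oo] --> (0 : R) ->
  inner (s k) h @[k --> \oo] --> inner f h.
Proof.
move=> s0; apply/cvgrPdist_le => e e0.
have : norm2 (s k - f) * norm2 h @[k --> \oo] --> (0 : R).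
  by rewrite -[X in _ --> X](mul0r (norm2 h)); exact: cvgMl.
move/cvgrPdist_le => /(_ _ e0); apply: filterS => k.
rewrite sub0r normrN ger0_norm ?mulr_ge0 ?norm2_ge0//; apply: le_trans.
by rewrite distrC -innerNl -innerDl cauchy_schwarz.
Qed.

End L2Limits.

(** * From orthogonal expansions to means and variances *)

Section Transfer.
Context {d : measure_display} {X : measurableType d} {R : realType}.
Context {mu : {measure set X -> \bar R}}.
Context {d' : measure_display} {Om : measurableType d'} {P : probability Om R}.

(** The constant variable 1 as a vector: a mean is the inner product with it, and centring is the
    projection onto its orthogonal complement. *)
Definition oneL2 : L2 P := Lfun_Sub (lee1n 2) (Lfun_cst P 1 2).

Lemma inner_oneL2 : inner oneL2 oneL2 = 1.
Proof.
rewrite /inner /Rintegral /=; under eq_integral do rewrite mulr1.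
by rewrite integral_cst//= mul1e probability_setT.
Qed.

Lemma expectation_L2 (Z : L2 P) : 'E_P[Z]%E = (inner Z oneL2)%:E.
Proof.
have Z1 : (Z : Om -> R) \in Lfun P 1.
  by apply: Lfun_subset12; [exact: fin_num_measure|exact: LfunP].
rewrite -(fineK (expectation_fin_num Z1)); congr (_%:E).
by rewrite unlock; apply: eq_Rintegral => w _; rewrite mulr1.
Qed.

Lemma variance_L2 (Z : L2 P) :
  'V_P[Z]%E = (norm2 (Z - inner Z oneL2 *: oneL2) ^+ 2)%:E.
Proof.
rewrite varianceE; last exact: LfunP.
rewrite expectation_L2 norm2_sqr.
have -> : 'E_P[(Z : Om -> R) ^+ 2]%E = (inner Z Z)%:E.
  rewrite unlock -norm2_sqr norm2_sqr_integral.
  by apply: eq_integral => w _; rewrite expr2.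
rewrite -EFin_expe -EFinB; congr (_%:E).
by rewrite !innerE (innerC oneL2) inner_oneL2; ring.
Qed.

(** Pythagoras on both sides reduces the comparison to one term at a time. *)
Lemma noise_norm2_le (m : nat) (r : R) (c : nat -> R) (e : nat -> L2 mu)
    (xi : nat -> L2 P) :
  (forall i j, (i < j < m)%N -> inner (e i) (e j) = 0) ->
  (forall i j, (i < j < m)%N -> inner (xi i) (xi j) = 0) ->
  (forall i, (i < m)%N -> inner (xi i) (xi i) <= inner (e i) (e i)) ->
  norm2 (r *: \sum_(i < m) c i *: xi i) <= `|r| * norm2 (\sum_(i < m) c i *: e i).
Proof.
move=> eo xo xe; rewrite norm2Z ler_wpM2l// !norm2E ler_wsqrtr//.
rewrite !inner_sum_orthogonal//; apply: ler_sum => i _.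
by rewrite ler_wpM2l ?sqr_ge0// xe.
Qed.

(** Inner products and norms are continuous. The mean is the limit of [<w k, h>], since the noise is
    orthogonal to 1. The norm of the centred approximant is at most [|<w k, h> - <u, h>| * norm2
    oneL2 + r * norm2 (w k)], which tends to [r * norm2 u]. *)
Lemma L2_limit_moments (u h : L2 mu) (Z : L2 P) (w : nat -> L2 mu)
    (N : nat -> L2 P) (r : R) :
  (forall k, inner (N k) oneL2 = 0) ->
  (forall k, norm2 (N k) <= r * norm2 (w k)) ->
  norm2 (w k - u) @[k --> \oo] --> (0 : R) ->
  norm2 (inner (w k) h *: oneL2 + N k - Z) @[k --> \oo] --> (0 : R) ->
  ('E_P[Z] = (inner u h)%:E)%E /\ ('V_P[Z] <= ((r * norm2 u) ^+ 2)%:E)%E.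
Proof.
move=> N0 Nr wu SZ.
have wh := cvg_inner (h := h) wu.
have Zm : inner Z oneL2 = inner u h.
  have := cvg_inner (h := oneL2) SZ.
  under eq_fun do rewrite innerDl innerZl inner_oneL2 mulr1 N0 addr0.
  by move=> H; exact: (cvg_unique _ H wh).
split; first by rewrite expectation_L2 Zm.
rewrite variance_L2 Zm lee_fin.
have SZc : norm2 ((inner (w k) h *: oneL2 + N k - inner u h *: oneL2) -
    (Z - inner u h *: oneL2)) @[k --> \oo] --> (0 : R).
  by under eq_fun do rewrite opprB addrA addrNK.
have := cvg_norm2 SZc; set z := norm2 _ => zc.
have bc : `|inner (w k) h - inner u h| * norm2 oneL2 + r * norm2 (w k)
    @[k --> \oo] --> `|inner u h - inner u h| * norm2 oneL2 + r * norm2 u.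
  apply: cvgD; last by apply: cvgMr; exact: cvg_norm2.
  by apply: cvgMl; apply: cvg_norm; apply: cvgB => //; exact: cvg_cst.
have zr : z <= r * norm2 u.
  move: bc; rewrite subrr normr0 mul0r add0r => bc.
  apply: (ler_cvg_to zc bc); near=> k.
  rewrite addrAC -scalerBl (le_trans (norm2D _ _))// norm2Z lerD2l.
  exact: Nr.
by rewrite lerXn2r// nnegrE ?(le_trans _ zr)// norm2_ge0.
Unshelve. all: by end_near. Qed.

End Transfer.

(** * Gaussian moments and independence *)

Section Density.
Import HBNNSimple.
Local Open Scope ereal_scope.
Context {d : measure_display} {X : measurableType d} {R : realType}.
Variables (nu mu : {measure set X -> \bar R}) (p : X -> R).
Hypotheses (mp : measurable_fun setT p) (p0 : forall x, (0 <= p x)%R).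
Hypothesis nuE : forall A, measurable A -> nu A = \int[mu]_(x in A) (p x)%:E.

Let nnsfun_density (h : {nnsfun X >-> R}) :
  \int[nu]_x (h x)%:E = \int[mu]_x ((h x)%:E * (p x)%:E).
Proof.
transitivity (\int[nu]_x (\sum_(y \in range h) (y * \1_(h @^-1` [set y]) x)%:E)).
  by apply: eq_integral => x _; rewrite fimfunE fsumEFin.
rewrite ge0_integral_fsum//; last 2 first.
- by move=> y; apply/measurable_EFinP; exact: measurable_funM.
- by move=> y x _; exact: nnfun_muleindic_ge0.
transitivity (\int[mu]_x (\sum_(y \in range h)
    ((y * \1_(h @^-1` [set y]) x)%:E * (p x)%:E))); last first.
  apply: eq_integral => x _; rewrite -ge0_mule_fsuml.
    by rewrite fsumEFin// -fimfunE.
  by move=> y; exact: nnfun_muleindic_ge0.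
rewrite ge0_integral_fsum//; last 2 first.
- move=> y; apply/measurable_EFinP; apply: measurable_funM => //.
  exact: measurable_funM.
- move=> y x _; apply: mule_ge0; [exact: nnfun_muleindic_ge0|].
  by rewrite lee_fin.
apply: eq_fsbigr => y _.
(* A nonnegative simple function has no negative values: for [y < 0] both sides vanish, and
   otherwise the factor [y] can be taken out of integrals of nonnegative functions. *)
have [y0|y0] := ltP y 0%R.
  rewrite preimage_nnfun0// !integral0_eq// => x _; by rewrite indicE in_set0 mulr0 ?mul0e.
under eq_integral do rewrite EFinM.
rewrite ge0_integralZl//; last exact/measurable_EFinP/measurable_indic.
rewrite integral_indic// setIT nuE//.
under [RHS]eq_integral do rewrite EFinM -muleA.
rewrite ge0_integralZl//; last 2 first.
- by apply: emeasurable_funM; apply/measurable_EFinP => //; exact: measurable_indic.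
- by move=> x _; rewrite mule_ge0 ?lee_fin.
congr (_ * _); rewrite integral_mkcond; apply: eq_integral => x _.
by rewrite patchE indicE; case: ifP; rewrite ?mul1e ?mul0e.
Qed.

(** Monotone convergence along increasing simple approximations of [f], applied on both sides. *)
Lemma ge0_integral_density (f : X -> \bar R) :
  measurable_fun setT f -> (forall x, 0 <= f x) ->
  \int[nu]_x f x = \int[mu]_x (f x * (p x)%:E).
Proof.
move=> mf f0; pose h := nnsfun_approx measurableT mf.
have fE x : EFin \o h ^~ x @ \oo --> f x by apply: cvg_nnsfun_approx.
transitivity (limn (fun n => \int[nu]_x (h n x)%:E)).
  under eq_integral => x _ do rewrite -(cvg_lim _ (fE x))//.
  apply: monotone_convergence => //.
  - by move=> n; apply/measurable_EFinP.
  - by move=> n x _; rewrite lee_fin.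
  - by move=> x _ a b ab; rewrite lee_fin; exact/lefP/nd_nnsfun_approx.
transitivity (limn (fun n => \int[mu]_x ((h n x)%:E * (p x)%:E))).
  by under eq_fun do rewrite nnsfun_density.
have fpE x : ((h n x)%:E * (p x)%:E) @[n --> \oo] --> f x * (p x)%:E.
  by apply: cvgeZr => //; exact: fE.
under [RHS]eq_integral => x _ do rewrite -(cvg_lim _ (fpE x))//.
apply/esym; apply: monotone_convergence => //.
- by move=> n; apply/measurable_EFinP; exact: measurable_funM.
- by move=> n x _; rewrite mule_ge0// lee_fin.
- by move=> x _ a b ab; rewrite lee_wpmul2r ?lee_fin//; exact/lefP/nd_nnsfun_approx.
Qed.

End Density.

(** * Second moment of the centred normal density *)

Section NormalMoments.
Context {R : realType}.
Variable s : R.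
Hypothesis s0 : 0 < s.

Let p : R -> R := normal_pdf 0 s.

(* Integrating F' = (x^2 - s^2) p over [-N, N], where F(N) <= 0 <= F(-N), bounds
   the truncated second moment by s^2. *)
Let F (x : R) : R := - (s ^+ 2 * x) * p x.

Lemma normal_pdf0E x : normal_pdf 0 s x =
  normal_peak s * expR (- x ^+ 2 / (s ^+ 2 *+ 2)).
Proof. by rewrite normal_pdfE ?gt_eqF// /normal_fun subr0. Qed.

Let dF (x : R) : is_derive x (1:R) F ((x ^+ 2 - s ^+ 2) * p x).
Proof.
have -> : F = (fun x => - (s ^+ 2 * x) *
   (normal_peak s * expR ((- (s ^+ 2 *+ 2)^-1) * x ^+ 2))).
  apply/funext => y; rewrite /F /p normal_pdf0E; congr (_ * (_ * expR _)).
  by rewrite mulNr mulrC mulNr.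
rewrite /p normal_pdf0E.
have -> : - x ^+ 2 / (s ^+ 2 *+ 2) = (- (s ^+ 2 *+ 2)^-1) * x ^+ 2.
  by rewrite mulNr mulrC mulNr.
apply: is_derive_eq.
rewrite /GRing.scale/=.
by field; rewrite gt_eqF.
Qed.

Let cp : continuous p.
Proof. by apply: continuous_normal_pdf; rewrite gt_eqF. Qed.

Let p_ge0 x : 0 <= p x. Proof. exact: normal_pdf_ge0. Qed.

Let mp : measurable_fun setT p. Proof. exact: measurable_normal_pdf. Qed.

Local Notation leb := (@lebesgue_measure R).

Let itv_integrable (N : R) (g : R -> R) : continuous g ->
  leb.-integrable `[- N, N] (EFin \o g).
Proof.
move=> cg; apply: continuous_compact_integrable; first exact: segment_compact.
exact/continuous_subspaceT.
Qed.

Let integral_itv_le0 (N : R) : 0 < N ->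
  (\int[leb]_(x in `[(- N)%R, N]) ((x ^+ 2 - s ^+ 2) * p x)%:E <= 0)%E.
Proof.
move=> N0.
have cF : continuous F.
  move=> x; apply: differentiable_continuous.
  exact/derivable1_diffP/(@ex_derive _ _ _ _ _ _ _ (dF x)).
rewrite (@continuous_FTC2 _ _ F).
- rewrite -EFinB lee_fin /F subr_le0 mulNr mulrN opprK.
  rewrite (@le_trans _ _ 0)// ?oppr_le0 !mulr_ge0 ?sqr_ge0// ltW//.
- lra.
- apply/continuous_subspaceT => x; apply: cvgM; last exact: cp.
  by apply: cvgB; [exact: exprn_continuous|exact: cvg_cst].
- split.
  + by move=> x _; exact: (@ex_derive _ _ _ _ _ _ _ (dF x)).
  + by apply: cvg_at_right_filter; exact: cF.
  + by apply: cvg_at_left_filter; exact: cF.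
- by move=> x _; rewrite derive1E; exact: (@derive_val _ _ _ _ _ _ _ (dF x)).
Qed.

Lemma normal_second_moment_le :
  (\int[leb]_x ((x ^+ 2)%:E * (normal_pdf 0 s x)%:E) <= (s ^+ 2)%:E)%E.
Proof.
(* The successor makes every interval nondegenerate, as the fundamental theorem of calculus
   requires. *)
pose I (i : nat) : set R := `[- i.+1%:R, i.+1%:R]%classic.
have cvgI : (\int[leb]_(x in I i) ((x ^+ 2)%:E * (p x)%:E))%E @[i --> \oo] -->
    (\int[leb]_(x in \bigcup_i I i) ((x ^+ 2)%:E * (p x)%:E))%E.
  apply: ge0_nondecreasing_set_cvg_integral.
  - apply/nondecreasing_seqP => i; rewrite subsetEset => x.
    rewrite /I /= !in_itv/= => /andP[x1 x2]; apply/andP; split.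
      by rewrite (le_trans _ x1)// lerN2 ler_nat.
    by rewrite (le_trans x2)// ler_nat.
  - by move=> i; exact: measurable_itv.
  - move=> i; apply: measurable_funTS; apply/measurable_EFinP.
    by apply: measurable_funM => //; exact: measurable_funX.
  - by move=> i x _; rewrite mule_ge0// lee_fin// sqr_ge0.
have IT : \bigcup_i I i = setT.
  rewrite -subTset => x _.
  have [N xN] : exists N : nat, `|x| <= N%:R.
    by have [N _ /(_ N (leqnn _)) /= ?] := nbhs_infty_ger `|x|; exists N.
  exists N => //; rewrite /I /= in_itv/= -ler_norml (le_trans xN)//.
  by rewrite ler_nat.
rewrite IT in cvgI; rewrite -(cvg_lim _ cvgI)//.
apply: lime_le; first by apply/cvg_ex; eexists; exact: cvgI.
near=> i.
have mI : measurable (I i) by exact: measurable_itv.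
have N0 : (0 : R) < i.+1%:R by [].
have c2 : continuous (fun x : R => (x ^+ 2 - s ^+ 2) * p x).
  move=> x; apply: cvgM; last exact: cp.
  by apply: cvgB; [exact: exprn_continuous|exact: cvg_cst].
have c1 : continuous (fun x : R => s ^+ 2 * p x).
  by move=> x; apply: cvgM; [exact: cvg_cst|exact: cp].
(* Splitting [x^2 = (x^2 - s^2) + s^2] leaves a nonpositive integral plus [s^2] times the mass of
   the density on the interval, which is at most 1. *)
have -> : (\int[leb]_(x in I i) ((x ^+ 2)%:E * (p x)%:E) =
    \int[leb]_(x in I i) (((x ^+ 2 - s ^+ 2) * p x)%:E + (s ^+ 2 * p x)%:E))%E.
  by apply: eq_integral => x _; rewrite -EFinD -EFinM; congr (_%:E); ring.
rewrite integralD//; last 2 first.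
- exact: itv_integrable c2.
- exact: itv_integrable c1.
rewrite -[leRHS]add0e leeD//; first exact: integral_itv_le0.
under eq_integral do rewrite EFinM.
rewrite ge0_integralZl//; last 3 first.
- exact/measurable_funTS/measurable_EFinP.
- by move=> x _; rewrite lee_fin.
- by rewrite lee_fin sqr_ge0.
rewrite -[leRHS]mule1 lee_wpmul2l// ?lee_fin ?sqr_ge0//.
rewrite -(integral_normal_pdf 0 s) ge0_subset_integral//.
- by apply/measurable_EFinP; exact: mp.
- by move=> x _; rewrite lee_fin.
Unshelve. all: by end_near. Qed.

End NormalMoments.

(** * Moments of a normally distributed variable *)

Section NormalLaw.
Context {d : measure_display} {Om : measurableType d} {R : realType}.
Context {P : probability Om R}.
Variables (s : R) (X : {mfun Om >-> R}).
Hypotheses (s0 : 0 < s) (lawX : has_law_normal P X 0 s).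
Local Notation leb := (@lebesgue_measure R).

Lemma ge0_integral_normal (f : R -> \bar R) :
  measurable_fun setT f -> (forall x, (0 <= f x)%E) ->
  (\int[P]_w f (X w) = \int[leb]_x (f x * (normal_pdf 0 s x)%:E))%E.
Proof.
move=> mf f0.
have mX : @measurable_fun _ _ Om (measurableTypeR R) setT X.
  exact: (measurable_funPT X).
(* The same map, retyped so that its distribution lives on the measurable space that carries
   Lebesgue measure. *)
pose X' : {mfun Om >-> measurableTypeR R} :=
  HB.pack (X : Om -> measurableTypeR R) (isMeasurableFun.Build _ _ _ _ _ mX).
rewrite -(@ge0_integral_density _ (measurableTypeR R) _ (distribution P X') leb)//.
- by rewrite ge0_integral_distribution.
- exact: measurable_normal_pdf.
- by move=> x; exact: normal_pdf_ge0.
Qed.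

Lemma normal_sqr_le : (\int[P]_w (X w ^+ 2)%:E <= (s ^+ 2)%:E)%E.
Proof.
rewrite (@ge0_integral_normal (fun x => (x ^+ 2)%:E)).
- exact: normal_second_moment_le.
- by apply/measurable_EFinP; exact: measurable_funX.
- by move=> x; rewrite lee_fin sqr_ge0.
Qed.

Lemma normal_L2 : (X : Om -> R) \in Lfun P 2%:E.
Proof.
by apply: L2_mem => //; apply: le_lt_trans normal_sqr_le _; rewrite ltry.
Qed.

(** The centred normal law is symmetric: its density is even and Lebesgue measure is invariant under
    reflection. *)
Lemma ge0_integral_normalN (f : R -> \bar R) :
  measurable_fun setT f -> (forall x, (0 <= f x)%E) ->
  (\int[P]_w f (- X w)%R = \int[P]_w f (X w))%E.
Proof.
move=> mf f0.
have mN : measurable_fun setT (-%R : R -> R) by exact: oppr_measurable.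
rewrite (@ge0_integral_normal (fun x => f (- x))) ?ge0_integral_normal//; last first.
  exact: measurableT_comp.
have mfp : measurable_fun setT (fun x => f x * (normal_pdf 0 s x)%:E)%E.
  apply: emeasurable_funM => //.
  by apply/measurable_EFinP; exact: measurable_normal_pdf.
transitivity (\int[pushforward leb (-%R : R -> measurableTypeR R)]_x
    (f x * (normal_pdf 0 s x)%:E))%E.
  have mN' : @measurable_fun _ _ (measurableTypeR R) (measurableTypeR R) setT -%R.
    exact: mN.
  have fp0 : {in [set: measurableTypeR R], forall x, (0 <= f x * (normal_pdf 0 s x)%:E)%E}.
    by move=> x _; rewrite mule_ge0// lee_fin normal_pdf_ge0.
  rewrite (ge0_integral_pushforward mN' leb measurableT mfp fp0) preimage_setT.
  apply: eq_integral => x _; rewrite /comp !normal_pdf0E//.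
  by rewrite sqrrN.
by apply: eq_measure_integral => //= A mA _; exact: lebesgue_measureN.
Qed.

(** By symmetry the positive and negative parts have the same integral, which is finite by square
    integrability. *)
Lemma normal_mean : (\int[P]_w X w = 0)%R.
Proof.
have posE : (\int[P]_w (EFin \o X)^\- w = \int[P]_w (EFin \o X)^\+ w)%E.
  transitivity (\int[P]_w (fun x => maxe x%:E 0) (- X w)%R)%E.
    by apply: eq_integral => w _; rewrite funenegE.
  rewrite (@ge0_integral_normalN (fun x => maxe x%:E 0)%E).
  - by apply: eq_integral => w _; rewrite funeposE.
  - by apply: measurable_maxe => //; exact/measurable_EFinP.
  - by move=> x; rewrite le_max lexx orbT.
rewrite /Rintegral integralE posE.
rewrite subee//.
have : P.-integrable setT (EFin \o X).
  apply/Lfun1_integrable/Lfun_subset12; first exact: fin_num_measure.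
  exact: normal_L2.
move=> /integrable_funepos => /(_ measurableT).
exact: integrable_fin_num.
Qed.

End NormalLaw.

(** * Independent variables are uncorrelated *)

Section Independence.
Context {d : measure_display} {Om : measurableType d} {R : realType}.
Context {P : probability Om R}.

Lemma mutually_independent_pair (J : choiceType) (X : J -> {mfun Om >-> R}) (i j : J)
    (A B : set R) : mutually_independent P (fun k => X k : Om -> R) -> i != j ->
  measurable A -> measurable B ->
  P (X i @^-1` A `&` X j @^-1` B) = (P (X i @^-1` A) * P (X j @^-1` B))%E.
Proof.
move=> ind ij mA mB.
have := ind [:: i; j] (fun k => if k == i then A else B).
rewrite !big_cons !big_nil/= eqxx eq_sym (negbTE ij) setIT mule1; apply.
  by rewrite inE ij.
by move=> k; case: ifP.
Qed.

(** The joint law agrees with the product of the marginals on rectangles, hence everywhere. Fubini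
    then computes the expectation by integrating [x * E Y = 0] over [x]. *)
Lemma independent_expectationM (X Y : {mfun Om >-> R}) :
  (X : Om -> R) \in Lfun P 2%:E -> (Y : Om -> R) \in Lfun P 2%:E ->
  (forall A B : set R, measurable A -> measurable B ->
    P (X @^-1` A `&` Y @^-1` B) = (P (X @^-1` A) * P (Y @^-1` B))%E) ->
  (\int[P]_w Y w = 0)%R ->
  (\int[P]_w (X w * Y w) = 0)%R.
Proof.
move=> X2 Y2 indXY EY0.
have XY1 : P.-integrable setT (EFin \o (fun w => X w * Y w)).
  by apply/Lfun1_integrable/Lfun2_mul_Lfun1.
pose XY w := (X w, Y w).
have mXY : measurable_fun setT XY by exact/measurable_fun_pair.
pose f (z : R * R) := (z.1 * z.2)%:E.
have mf : measurable_fun setT f.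
  by apply/measurable_EFinP; exact: measurable_funM.
have prodE (A : set (R * R)) : measurable A ->
    (distribution P X \x distribution P Y)%E A = pushforward P XY A.
  by apply: product_measure_unique => A1 A2 mA1 mA2; exact: indXY.
have intf : (distribution P X \x distribution P Y)%E.-integrable setT f.
  apply/integrableP; split => //.
  rewrite (eq_measure_integral (pushforward P XY)); last by move=> A mA _; exact: prodE.
  rewrite ge0_integral_pushforward//=; first by have /integrableP[_] := XY1.
  by apply/measurable_EFinP; apply: measurableT_comp => //; exact: measurable_funM.
rewrite /Rintegral.
have -> : (\int[P]_w (X w * Y w)%:E =
    \int[(distribution P X \x distribution P Y)%E]_z f z)%E.
  rewrite (eq_measure_integral (pushforward P XY)); last by move=> A mA _; exact: prodE.
  by rewrite integral_pushforward.
rewrite -integral12_prod_meas1// integral0_eq// => x _.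
rewrite /fubini_F /f/=.
have Y1 : P.-integrable setT (EFin \o Y).
  by apply/Lfun1_integrable/Lfun_subset12 => //; exact: fin_num_measure.
rewrite (@integral_distribution _ _ _ _ _ _ Y (fun y => (x * y)%:E)).
- under eq_integral do rewrite /= EFinM.
  rewrite integralZl//.
  rewrite -(fineK (integrable_fin_num _ Y1))//.
  by move: EY0; rewrite /Rintegral => ->; rewrite mule0.
- by apply/measurable_EFinP; exact: measurable_funM.
- by apply: (eq_integrable _ (fun w => x%:E * (Y w)%:E)%E) => //; exact: integrableZl.
Qed.

End Independence.

(** * Observation models *)

Section L2of.
Context {d : measure_display} {X : measurableType d} {R : realType}.
Context {mu : {measure set X -> \bar R}}.

(* Junk value: 0 when [f] is not square integrable. *)
Definition L2of (f : X -> R) : L2 mu := insubd (0 : L2 mu) f.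

Lemma L2ofE (f : X -> R) : f \in Lfun mu 2%:E -> (L2of f : X -> R) = f.
Proof. by move=> fL2; rewrite /L2of -[LHS]/(val _) insubdK. Qed.

(** The restricted measure has density [\1_D]; signed integrands are split into positive and
    negative parts. *)
Lemma integral_mrestr (D : set X) (mD : measurable D) (f : X -> \bar R) :
  measurable_fun setT f ->
  (\int[mrestr mu mD]_x f x = \int[mu]_(x in D) f x)%E.
Proof.
have ge0_integral_mrestr (g : X -> \bar R) : measurable_fun setT g ->
    (forall x, (0 <= g x)%E) ->
    (\int[mrestr mu mD]_x g x = \int[mu]_(x in D) g x)%E.
  move=> mg g0; rewrite (@ge0_integral_density _ _ _ _ mu (\1_D))//.
  - rewrite [RHS]integral_mkcond; apply: eq_integral => x _.
    by rewrite patchE indicE; case: ifP; rewrite ?mule1 ?mule0.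
  - by move=> A mA; rewrite integral_indic// setIC.
move=> mf; rewrite [LHS]integralE [RHS]integralE !ge0_integral_mrestr//.
- exact: measurable_funeneg.
- exact: measurable_funepos.
Qed.

End L2of.

Section MeanSquare.
Context {d : measure_display} {Om : measurableType d} {R : realType}.
Context {P : probability Om R}.

Lemma L2_of_close (Z : {mfun Om >-> R}) (S : L2 P) :
  (\int[P]_w ((Z w - S w) ^+ 2)%:E < +oo)%E -> (Z : Om -> R) \in Lfun P 2%:E.
Proof.
move=> ZS.
have : (fun w => Z w - S w) \in Lfun P 2%:E.
  by apply: L2_mem => //; exact: measurable_funB.
move=> ZS2.
suff -> : (Z : Om -> R) = L2of (fun w => Z w - S w) + S by exact: LfunP.
by apply/funext => w /=; rewrite fctE/= L2ofE// subrK.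
Qed.

(** Once [b k < 1], [Z] is at finite mean-square distance from a square-integrable variable, so it
    is square integrable and [L2of Z] is not the junk value. *)
Lemma mean_square_limit (Z : {mfun Om >-> R}) (S : nat -> L2 P) (b : nat -> \bar R) :
  (forall k, (\int[P]_w ((Z w - S k w) ^+ 2)%:E <= b k)%E) ->
  b k @[k --> \oo] --> 0%E ->
  (Z : Om -> R) \in Lfun P 2%:E /\ norm2 (S k - L2of Z) @[k --> \oo] --> (0 : R).
Proof.
move=> Sb b0.
have ZL2 : (Z : Om -> R) \in Lfun P 2%:E.
  have : \forall k \near \oo, (b k < 1%:E)%E.
    exact: b0 _ (@nbhs_open_ereal_lt _ 0 (fun=> 1) ltr01).
  move=> [N _ /(_ N (leqnn N))/= bN].
  apply: (@L2_of_close Z (S N)).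
  by rewrite (le_lt_trans (Sb N))// (lt_trans bN)// ltry.
split=> //; apply: cvg_norm2_0 b0; apply: nearW => k.
rewrite norm2B norm2_sqr_integral; apply: le_trans (Sb k).
rewrite le_eqVlt; apply/orP; left; apply/eqP; apply: eq_integral => w _ /=.
by rewrite fctE/= L2ofE.
Qed.

(** Serves to convert almost sure convergence of a series into mean-square bounds. Almost everywhere
    [g] is the limit inferior of the [f j], to which Fatou's lemma applies. *)
Lemma fatou_ae (f : nat -> Om -> \bar R) (g : Om -> \bar R) (b : nat -> \bar R) (l : \bar R) :
  (forall j, measurable_fun setT (f j)) -> (forall j w, (0 <= f j w)%E) ->
  measurable_fun setT g ->
  {ae P, forall w, f j w @[j --> \oo] --> g w} ->
  (forall j, (\int[P]_w f j w <= b j)%E) -> b j @[j --> \oo] --> l ->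
  (\int[P]_w g w <= l)%E.
Proof.
move=> mf f0 mg fg fb bl.
have -> : (\int[P]_w g w = \int[P]_w limn_einf (f^~ w))%E.
  apply: ae_eq_integral => //.
  - apply: measurableT_comp => //; apply: measurable_fun_limn_esup => j.
    exact: measurableT_comp.
  - by apply: filterS fg => w fgw _; have [-> _] := cvg_limn_einf_sup fgw.
apply: (le_trans (fatou _ _ _ _)) => //.
have [<- _] := cvg_limn_einf_sup bl.
rewrite !limn_einf_lim; apply: lee_lim; [exact: is_cvg_einfs..|].
apply: nearW => k; apply: le_ereal_inf_tmp => _ [p /= kp <-].
by apply: le_trans (fb p); apply: ereal_inf_lbound; exists p.
Qed.

End MeanSquare.

(** * White noise: indicators of intervals and Brownian increments *)

Section WhiteNoise.
Context {R : realType}.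
Variable I : interval R.
Local Notation mu := (lebesgue_on I).
Local Notation leb := (@lebesgue_measure R).

Definition indicL2 (a b : R) : L2 mu :=
  @L2of _ (measurableTypeR R) R mu (\1_(`]a, b]%classic)).

Lemma lebesgue_onE (A : set R) : measurable A -> mu A = leb (A `&` [set` I]).
Proof. by []. Qed.

Lemma indicL2E (a b : R) : (indicL2 a b : R -> R) = \1_(`]a, b]%classic).
Proof.
rewrite /indicL2 L2ofE//; apply: L2_mem; first exact: measurable_indic.
rewrite (eq_integral (fun x : measurableTypeR R => (\1_(`]a, b]%classic) x)%:E)).
  rewrite integral_indic// setIT lebesgue_onE//.
  apply: (@le_lt_trans _ _ (leb `]a, b]%classic)).
    by apply: le_measure; rewrite ?inE//; exact: measurableI.
  by rewrite lebesgue_measure_itv/=; case: ifP => // _; rewrite -EFinB ltry.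
by move=> x _; rewrite indicE; case: (_ \in _); rewrite ?expr1n// expr0n.
Qed.

Lemma itv_oc_sub (a b : R) : a \in I -> b \in I -> `]a, b]%classic `<=` [set` I].
Proof.
move=> aI bI x /=; rewrite in_itv/= => /andP[ax xb].
by have := @interval_is_interval R I; apply; [exact: aI|exact: bI|rewrite (ltW ax)].
Qed.

Lemma inner_indicL2 (a b : R) : a \in I -> b \in I -> a < b ->
  inner (indicL2 a b) (indicL2 a b) = b - a.
Proof.
move=> aI bI ab; rewrite /inner /Rintegral indicL2E.
rewrite (eq_integral (fun x : measurableTypeR R => (\1_(`]a, b]%classic) x)%:E)).
  rewrite integral_indic// setIT lebesgue_onE// setIidl; last exact: itv_oc_sub.
  by rewrite lebesgue_measure_itv/= lte_fin ab -EFinB.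
by move=> x _; rewrite indicE; case: (_ \in _); rewrite ?mulr1// mulr0.
Qed.

Lemma inner_indicL2_disjoint (a b a' b' : R) : b <= a' ->
  inner (indicL2 a b) (indicL2 a' b') = 0.
Proof.
move=> ba'; rewrite /inner /Rintegral !indicL2E integral0_eq// => x _.
rewrite !indicE !mem_setE !in_itv/=.
have [xb|] := leP x b; last by rewrite andbF mul0r.
by rewrite [a' < x]ltNge (le_trans xb ba') mulr0.
Qed.

Lemma inner_indicL2_l (a b : R) (h : L2 mu) : a \in I -> b \in I -> a < b ->
  inner (indicL2 a b) h = (\int[leb]_(x in `[a, b]) h x)%R.
Proof.
move=> aI bI ab.
have mh : measurable_fun setT (h : measurableTypeR R -> R) by [].
have intm : mu.-integrable setT (EFin \o (fun x => indicL2 a b x * h x)).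
  exact: integrable_mulL2.
(* The outer function [g] allows two uses: the identity gives the value of the integral, and the
   absolute value gives the integrability of [h] on the interval. *)
have E (g : \bar R -> \bar R) : measurable_fun setT g -> g 0%E = 0%E ->
  (\int[mu]_x g (indicL2 a b x * h x)%:E = \int[leb]_(x in `]a, b]) g (h x)%:E)%E.
  move=> mg g0.
  rewrite /lebesgue_on integral_mrestr; last first.
    apply: measurableT_comp => //; apply/measurable_EFinP.
    by apply: measurable_funM.
  rewrite integral_mkcond [RHS]integral_mkcond; apply: eq_integral => x _.
  rewrite !patchE indicL2E indicE.
  have [xab|xab] := boolP (x \in `]a, b]%classic); last first.
    by rewrite mul0r g0; case: ifP.
  rewrite mul1r mem_set//; apply: (itv_oc_sub aI bI); exact: set_mem.
rewrite -Rintegral_itv_obnd_cbnd.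
  by rewrite /inner /Rintegral (E id).
apply/integrableP; split; first exact/measurable_funTS/measurable_EFinP.
by rewrite -(E abse)// ?abse0//; have /integrableP[] := intm.
Qed.

Lemma step_functionE (m : nat) (t c : nat -> R) :
  ((\sum_(i < m) c i *: indicL2 (t i) (t i.+1)) : R -> R) = step_function m t c.
Proof.
apply/funext => x; rewrite (L2_sumE m c (fun i => indicL2 (t i) (t i.+1))) /step_function.
by apply: eq_bigr => i _; rewrite indicL2E.
Qed.

End WhiteNoise.

Lemma homo_ltn_upto {R : realType} (m : nat) (t : nat -> R) :
  (forall i, (i < m)%N -> t i < t i.+1) ->
  forall i j, (i < j <= m)%N -> t i.+1 <= t j.
Proof.
move=> tlt i; elim=> [//|j IH] /andP[].
rewrite ltnS leq_eqVlt => /predU1P[->//|ij] jm.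
apply: (le_trans (IH _)); first by rewrite ij; exact: ltnW.
exact/ltW/tlt.
Qed.

Section WhiteNoiseSum.
Context {R : realType} {d : measure_display} {Om : measurableType d}.
Context {P : probability Om R}.
Variables (I : interval R) (o : R) (W : R -> {mfun Om >-> R}).
Hypothesis bmW : brownian_motion P I o W.
Variables (m : nat) (t c : nat -> R).
Hypotheses (tI : forall i, (i <= m)%N -> t i \in I)
  (tlt : forall i, (i < m)%N -> t i < t i.+1).

Let dW (i : nat) : {mfun Om >-> R} := W (t i.+1) - W (t i).

Let law_dW i : (i < m)%N ->
  has_law_normal P (dW i) 0 (Num.sqrt (t i.+1 - t i)).
Proof.
move=> im; have [_ _ _ law _] := bmW.
by apply: law; [exact/tI/ltnW|exact: tI|exact: tlt].
Qed.

Let sd_gt0 i : (i < m)%N -> 0 < Num.sqrt (t i.+1 - t i).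
Proof. by move=> im; rewrite sqrtr_gt0 subr_gt0 tlt. Qed.

Let xi (i : nat) : L2 P := L2of (dW i).

(** Only increments with index below [m] are known to be normal, hence square integrable; elsewhere
    [L2of] could return its junk value. *)
Let xiE i : (i < m)%N -> (xi i : Om -> R) = dW i.
Proof.
by move=> im; rewrite /xi L2ofE//; exact: normal_L2 (sd_gt0 im) (law_dW im).
Qed.

Let inner_xi_xi i : (i < m)%N -> inner (xi i) (xi i) <= t i.+1 - t i.
Proof.
move=> im; rewrite -norm2_sqr -lee_fin norm2_sqr_integral xiE//.
rewrite (le_trans (normal_sqr_le (sd_gt0 im) (law_dW im)))//.
by rewrite sqr_sqrtr// subr_ge0 ltW// tlt.
Qed.

Let mean_xi i : (i < m)%N -> inner (xi i) oneL2 = 0.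
Proof.
move=> im; rewrite -(normal_mean (sd_gt0 im) (law_dW im)) /inner xiE//.
by apply: eq_Rintegral => w _; rewrite /= mulr1.
Qed.

Let xi_orthogonal i j : (i < j < m)%N -> inner (xi i) (xi j) = 0.
Proof.
move=> /andP[ij jm]; have im := ltn_trans ij jm.
rewrite /inner !xiE//; apply: independent_expectationM.
- exact: normal_L2 (sd_gt0 im) (law_dW im).
- exact: normal_L2 (sd_gt0 jm) (law_dW jm).
- move=> A B mA mB; have [_ _ _ _ /(_ m t tI tlt) ind] := bmW.
  apply: (@mutually_independent_pair _ _ _ _ _ (fun i : 'I_m => dW i)
    (Ordinal im) (Ordinal jm)) => //.
  by rewrite -val_eqE /= ltn_eqF.
- exact: normal_mean (sd_gt0 jm) (law_dW jm).
Qed.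

Let e (i : nat) : L2 (lebesgue_on I) := indicL2 I (t i) (t i.+1).

(** On each subinterval the increment of [Y] is [<e i, h> + r * dW i]. The noise is thus [r] times
    the sum of the [c i *: dW i]; these increments are centred and orthogonal, with second moment at
    most the length [<e i, e i>]. *)
Lemma white_noise_sum (r : R) (h : L2 (lebesgue_on I)) (Y : R -> {mfun Om >-> R}) :
  0 <= r ->
  {ae P, forall w, forall s t, s \in I -> t \in I -> s <= t ->
      Y t w - Y s w = \int[lebesgue_measure]_(x in `[s, t]) h x +
        r * (W t w - W s w)} ->
  exists N : L2 P, [/\ inner N oneL2 = 0,
    norm2 N <= r * norm2 (\sum_(i < m) c i *: e i) &
    {ae P, forall w, step_integral m t c Y w =
      inner (\sum_(i < m) c i *: e i) h + N w}].
Proof.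
move=> r0 Yae; exists (r *: \sum_(i < m) c i *: xi i); split.
- by rewrite innerZl inner_suml big1 ?mulr0// => i _; rewrite mean_xi ?mulr0.
- rewrite -[X in X * _]ger0_norm//; apply: noise_norm2_le.
  + move=> i j /andP[ij jm]; apply: inner_indicL2_disjoint.
    by apply: (homo_ltn_upto tlt); rewrite ij ltnW.
  + exact: xi_orthogonal.
  + move=> i im; rewrite inner_indicL2; last exact: tlt.
    * exact: inner_xi_xi.
    * exact/tI/ltnW.
    * exact: tI.
- apply: filterS Yae => w Yw.
  have -> : (r *: (\sum_(i < m) c i *: xi i)) w = r * (\sum_(i < m) c i *: xi i) w.
    by [].
  rewrite /step_integral inner_suml (L2_sumE m c xi) mulr_sumr -big_split/=.
  apply: eq_bigr => i _; have im := ltn_ord i.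
  have tiI : t i \in I by exact/tI/ltnW.
  have ti1I : t i.+1 \in I by exact: tI.
  have tii1 := tlt im.
  by rewrite (Yw _ _ tiI ti1I (ltW tii1)) inner_indicL2_l// xiE//= mulrDr (mulrCA r).
Qed.

End WhiteNoiseSum.

(** * Moments of the limiting integral and of the estimator *)

Section EstimatorMoments.
Context {d : measure_display} {X : measurableType d} {R : realType}.
Context {mu : {measure set X -> \bar R}}.
Context {d' : measure_display} {Om : measurableType d'}.

(* [r] stands for the noise level n^{-1/2}. *)
Definition has_integral_moments (P : probability Om R) (r : R) (u h : L2 mu)
    (Z : Om -> R) : Prop :=
  [/\ Z \in Lfun P 2%:E, ('E_P[Z] = (inner u h)%:E)%E &
      ('V_P[Z] <= ((r * norm2 u) ^+ 2)%:E)%E].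

Lemma integral_moments_limit (P : probability Om R) (r : R) (u h : L2 mu)
    (Z : {mfun Om >-> R}) (w : nat -> L2 mu) (N : nat -> L2 P) (b : nat -> \bar R) :
  (forall k, inner (N k) oneL2 = 0) ->
  (forall k, norm2 (N k) <= r * norm2 (w k)) ->
  norm2 (w k - u) @[k --> \oo] --> (0 : R) ->
  (forall k, (\int[P]_o ((Z o - (inner (w k) h + N k o)) ^+ 2)%:E <= b k)%E) ->
  b k @[k --> \oo] --> 0%E ->
  has_integral_moments P r u h Z.
Proof.
move=> N0 Nr wu Zb b0.
pose S k : L2 P := inner (w k) h *: oneL2 + N k.
have SE k o : S k o = inner (w k) h + N k o.
  exact: (congr1 (fun z => z + N k o) (mulr1 _)).
have [Z2 SZ] : (Z : Om -> R) \in Lfun P 2%:E /\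
    norm2 (S k - L2of Z) @[k --> \oo] --> (0 : R).
  apply: mean_square_limit b0 => k.
  by under eq_integral do rewrite SE.
have [EZ VZ] := L2_limit_moments N0 Nr wu SZ.
by split => //; rewrite L2ofE in EZ VZ.
Qed.

Lemma affine_moments (P : probability Om R) (r a k : R) (u h : L2 mu) (Z : Om -> R) :
  has_integral_moments P r u h Z ->
  ('E_P[(fun o => a + k * Z o)%R] = (a + k * inner u h)%:E)%E /\
  ('V_P[(fun o => a + k * Z o)%R] <= ((k * r * norm2 u) ^+ 2)%:E)%E.
Proof.
move=> [Z2 EZ VZ].
have TE : (fun o => a + k * Z o) = (cst a \+ (k \o* Z)).
  by apply/funext => o /=; rewrite mulrC.
have Z1 : Z \in Lfun P 1 by apply: Lfun_subset12 => //; exact: fin_num_measure.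
have kZ2 : k \o* Z \in Lfun P 2%:E by apply: Lfun_scale; rewrite ?ler1n.
rewrite TE; split.
  rewrite expectationD ?Lfun_cst ?Lfun_scale// expectation_cst expectationZl// EZ.
  by rewrite -EFinM -EFinD.
rewrite varianceD_cst_l// varianceZ//.
rewrite -mulrA exprMn [leRHS]EFinM.
by rewrite lee_wpmul2l// lee_fin sqr_ge0.
Qed.

End EstimatorMoments.

Lemma white_noise_moments (R : realType) (n : R) (I : interval R)
    (d : measure_display) (Om : measurableType d)
    (P : L2 (lebesgue_on I) -> probability Om R) (Y : R -> {mfun Om >-> R})
    (Z : {mfun Om >-> R}) (u h : L2 (lebesgue_on I)) :
  white_noise_model n P Y -> is_integral_dY (P h) Y u Z ->
  has_integral_moments (P h) (Num.sqrt n)^-1 u h Z.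
Proof.
move=> /(_ h) [w0 [W [bmW Yae]]] [m [t [c [tI tlt stepu SZ]]]].
have r0 : 0 <= (Num.sqrt n)^-1 by rewrite invr_ge0 sqrtr_ge0.
pose w k : L2 (lebesgue_on I) :=
  \sum_(i < m k) c k i *: indicL2 I (t k i) (t k i.+1).
have /choice[N NP] : forall k, exists N : L2 (P h), [/\ inner N oneL2 = 0,
    norm2 N <= (Num.sqrt n)^-1 * norm2 (w k) &
    {ae P h, forall x, step_integral (m k) (t k) (c k) Y x = inner (w k) h + N x}].
  by move=> k; exact: (white_noise_sum bmW (c k) (tI k) (tlt k) r0 Yae).
apply: (@integral_moments_limit _ _ _ _ _ _ _ _ _ _ _ w N _ _ _ _ _ SZ).
- by move=> k; have [] := NP k.
- by move=> k; have [] := NP k.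
- apply: cvg_norm2_0 stepu; apply: nearW => k.
  rewrite norm2_sqr_integral le_eqVlt; apply/orP; left; apply/eqP.
  apply: eq_integral => x _ /=.
  by rewrite -(step_functionE I) fctE.
(* The step integral equals signal plus noise almost surely, so both have the same mean-square
   distance to [Z]. *)
- move=> k; have [_ _ SN] := NP k.
  rewrite unlock le_eqVlt; apply/orP; left; apply/eqP.
  apply: ae_eq_integral => //.
  + apply/measurable_EFinP/measurable_funX/measurable_funB => //.
    exact: measurable_funD.
  + apply/measurable_EFinP/measurable_funX/measurable_funB => //.
    apply: measurable_sum => i; apply: measurable_funM => //.
    exact: measurable_funB.
  + by apply: filterS SN => o' -> _.
Qed.

(** * Sequence model: coordinate vectors and truncations *)

Section Sequence.
Context {R : realType}.
Local Notation mu := (@counting_nat R).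

Let counting_set1 (i : nat) : mu [set i] = 1%E.
Proof.
rewrite /counting_nat/= /counting asboolT; last exact: finite_set1.
by rewrite fset_set1 finmap.cardfs1.
Qed.

Definition coordL2 (i : nat) : L2 mu := L2of (\1_[set i] : nat -> R).

Lemma coordL2E i : (coordL2 i : nat -> R) = \1_[set i].
Proof.
rewrite /coordL2 L2ofE//; apply: L2_mem; first exact: measurable_indic.
rewrite (eq_integral (fun x => (\1_[set i] x)%:E)).
  by rewrite integral_indic// setIT counting_set1 ltry.
by move=> x _; rewrite indicE; case: (_ \in _); rewrite ?expr1n// expr0n.
Qed.

Lemma inner_coordL2 i (h : L2 mu) : inner (coordL2 i) h = h i.
Proof.
rewrite /inner /Rintegral coordL2E.
rewrite (eq_integral (fun x => (h i)%:E * (\1_[set i] x)%:E)%E).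
  rewrite integralZl//; first by rewrite integral_indic// setIT counting_set1 mule1.
  apply/integrableP; split; first exact/measurable_EFinP/measurable_indic.
  under eq_integral do rewrite gee0_abs ?lee_fin//.
  by rewrite integral_indic// setIT counting_set1 ltry.
move=> x _; rewrite -EFinM indicE mulrC.
have [|_] := boolP (x \in [set i]); last by rewrite !mulr0.
by rewrite inE => ->.
Qed.

Lemma truncationE (u : nat -> R) (k i : nat) :
  (\sum_(j < k) u j *: coordL2 j) i = if (i < k)%N then u i else 0.
Proof.
rewrite (L2_sumE k u coordL2); under eq_bigr do rewrite coordL2E indicE.
have [ik|ki] := ltnP i k.
  rewrite (bigD1 (Ordinal ik))//= mem_set// mulr1 big1 ?addr0// => j ji.
  by rewrite memNset ?mulr0// => /= ij; case/eqP: ji; apply: val_inj.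
rewrite big1// => j _; rewrite memNset ?mulr0//= => ij.
by have := ltn_ord j; rewrite -ij ltnNge ki.
Qed.

Lemma truncation_cvg (u : L2 mu) :
  norm2 (\sum_(j < k) u j *: coordL2 j - u) @[k --> \oo] --> (0 : R).
Proof.
pose f k i : \bar R := (((\sum_(j < k) u j *: coordL2 j - u) i) ^+ 2)%:E.
have fE k i : f k i = (if (i < k)%N then 0 else u i ^+ 2)%:E.
  rewrite /f /= fctE truncationE; case: ifP => _; first by rewrite subrr expr0n.
  by rewrite sub0r sqrrN.
have : (\int[mu]_i f k i)%E @[k --> \oo] --> (\int[mu]_i (cst 0%E) i)%E.
  (* The integrand is dominated by [u i ^+ 2], and its value at [i] is 0 as soon as [k > i]. *)
  have := @dominated_convergence _ _ _ mu setT measurableT f (cst 0%E)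
    (fun i => (u i ^+ 2)%:E).
  case => //.
  - apply/aeW => i _; apply: (@cvg_near_cst _ _ _ _ _ _ _).
    by exists i.+1 => // k /= ik; rewrite fE ik.
  - exact: Lfun2_integrable_sqr (LfunP u).
  - apply/aeW => i k _; rewrite fE; case: ifP => _; rewrite ?abse0 ?lee_fin ?sqr_ge0//.
    by rewrite ger0_norm ?sqr_ge0.
rewrite integral0; apply: cvg_norm2_0; apply: nearW => k.
by rewrite norm2_sqr_integral.
Qed.

End Sequence.

(** A tail is rewritten as a full sum with its first [k] coefficients set to zero, so that the norm
    bounds for sums starting at 0 apply to it. *)
Lemma big_tail (R : pzRingType) (V : lmodType R) (c : nat -> R) (e : nat -> V) (k j : nat) :
  \sum_(i < j + k) c i *: e i - \sum_(i < k) c i *: e i =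
  \sum_(i < j + k) (if (k <= i)%N then c i else 0) *: e i.
Proof.
elim: j => [|j IH].
  rewrite add0n subrr big1// => i _.
  by rewrite leqNgt ltn_ord scale0r.
by rewrite addSn !big_ord_recr/= addrAC IH leq_addl.
Qed.

Lemma norm2_le_pointwise (d : measure_display) (X : measurableType d) (R : realType)
    (mu : {measure set X -> \bar R}) (f g : L2 mu) :
  (forall x, f x ^+ 2 <= g x ^+ 2) -> norm2 f <= norm2 g.
Proof.
move=> fg; rewrite -ler_sqr ?nnegrE ?norm2_ge0// -lee_fin !norm2_sqr_integral.
apply: ge0_le_integral => //.
- by move=> x _; rewrite lee_fin sqr_ge0.
- exact/measurable_EFinP/measurable_funX.
- exact/measurable_EFinP/measurable_funX.
- by move=> x _; rewrite lee_fin.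
Qed.

(** The series is only assumed to converge almost surely. Its partial sums satisfy a mean-square
    Cauchy bound, and Fatou's lemma transfers that bound to the distance from [Z]. *)
Lemma sequence_moments (R : realType) (n : R)
    (d : measure_display) (Om : measurableType d)
    (P : L2 (counting_nat R) -> probability Om R) (Y : nat -> {mfun Om >-> R})
    (Z : {mfun Om >-> R}) (u h : L2 (counting_nat R)) :
  sequence_model n P Y -> is_series_Y (P h) Y u Z ->
  has_integral_moments (P h) (Num.sqrt n)^-1 u h Z.
Proof.
move=> /(_ h) [xi [law_xi ind_xi Yae]] SY.
set r := (Num.sqrt n)^-1 in Yae *.
have r0 : 0 <= r by rewrite invr_ge0 sqrtr_ge0.
pose x i : L2 (P h) := L2of (xi i).
have xL2 i : (xi i : Om -> R) \in Lfun (P h) 2%:E := normal_L2 ltr01 (law_xi i).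
have xE i : (x i : Om -> R) = xi i by rewrite /x L2ofE.
have x_mean i : inner (x i) oneL2 = 0.
  rewrite -(normal_mean ltr01 (law_xi i)) /inner xE.
  by apply: eq_Rintegral => o _; rewrite /= mulr1.
have x_orth i j : (i < j)%N -> inner (x i) (x j) = 0.
  move=> ij; rewrite /inner !xE; apply: independent_expectationM => //.
    move=> A B mA mB; apply: mutually_independent_pair ind_xi _ mA mB.
    by rewrite ltn_eqF.
  exact: normal_mean ltr01 (law_xi j).
have x_sqr i : inner (x i) (x i) <= inner (coordL2 (R := R) i) (coordL2 i).
  rewrite inner_coordL2 coordL2E indicE mem_set//= -norm2_sqr -lee_fin.
  rewrite norm2_sqr_integral xE (le_trans (normal_sqr_le ltr01 (law_xi i)))//.
  by rewrite expr1n.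
have coord_orth i j : (i < j)%N -> inner (coordL2 (R := R) i) (coordL2 j) = 0.
  move=> ij; rewrite inner_coordL2 coordL2E indicE memNset//= => ji.
  by move: ij; rewrite ji ltnn.
have noise (m : nat) (c : nat -> R) : norm2 (r *: \sum_(i < m) c i *: x i) <=
    r * norm2 (\sum_(i < m) c i *: coordL2 i).
  rewrite -[X in X * _]ger0_norm//; apply: noise_norm2_le.
  - by move=> i j /andP[ij _]; exact: coord_orth.
  - by move=> i j /andP[ij _]; exact: x_orth.
  - by move=> i _; exact: x_sqr.
pose w k : L2 (counting_nat R) := \sum_(i < k) u i *: coordL2 i.
pose N k : L2 (P h) := r *: \sum_(i < k) u i *: x i.
pose S k : L2 (P h) := inner (w k) h *: oneL2 + N k.
have SE k o : S k o = inner (w k) h + N k o.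
  exact: (congr1 (fun z => z + N k o) (mulr1 _)).
(* The bound does not depend on [j]. The signal part is controlled by Cauchy-Schwarz and the noise
   part by [noise], both in terms of the tail of [u] beyond [k]. *)
have S_diff j k : norm2 (S (j + k)%N - S k) <= (norm2 h + r) * norm2 (w k - u).
  pose c i := if (k <= i)%N then u i else 0.
  have wE : w (j + k)%N - w k = \sum_(i < j + k) c i *: coordL2 i by exact: big_tail.
  have -> : S (j + k)%N - S k = inner (w (j + k)%N - w k) h *: oneL2 +
      r *: \sum_(i < j + k) c i *: x i.
    rewrite -big_tail scalerBr innerDl innerNl scalerBl opprD addrACA.
    by rewrite addrACA.
  have wu : norm2 (w (j + k)%N - w k) <= norm2 (w k - u).
    apply: norm2_le_pointwise => i.
    rewrite wE (truncationE c).
    have -> : (w k - u) i = w k i - u i by [].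
    rewrite (truncationE u) /c; have [ik|ki] := ltnP i k.
      by rewrite if_same expr0n sqr_ge0.
    by case: ifP; rewrite sub0r sqrrN// expr0n sqr_ge0.
  apply: le_trans (norm2D _ _) _; rewrite norm2Z.
  have -> : norm2 (oneL2 (P := P h)) = 1 by rewrite norm2E inner_oneL2 sqrtr1.
  rewrite mulr1 mulrDl lerD//.
    rewrite (le_trans (cauchy_schwarz _ _))// mulrC ler_wpM2l// norm2_ge0//.
  rewrite (le_trans (noise _ _))// -wE ler_wpM2l//.
pose b k : \bar R := (((norm2 h + r) * norm2 (w k - u)) ^+ 2)%:E.
have Zb k : (\int[P h]_o ((Z o - (inner (w k) h + N k o)) ^+ 2)%:E <= b k)%E.
  under eq_integral do rewrite -SE.
  (* Here [k] is fixed and [j] tends to infinity: [S (j + k)] converges almost surely to [Z]. *)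
  apply: (@fatou_ae _ _ _ _ (fun j o => ((S (j + k)%N o - S k o) ^+ 2)%:E) _ (fun=> b k)).
  - move=> j; exact/measurable_EFinP/measurable_funX/measurable_funB.
  - by move=> j o; rewrite lee_fin sqr_ge0.
  - exact/measurable_EFinP/measurable_funX/measurable_funB.
  - apply: filterS2 Yae SY => o Yo SYo; apply: cvg_EFin; first exact: nearW.
    apply: (@cvg_comp _ _ _ (fun j => S (j + k)%N o - S k o) (fun z => z ^+ 2)); last first.
      exact: exprn_continuous.
    apply: cvgB; last exact: cvg_cst.
    rewrite (cvg_shiftn k (fun j => S j o)).
    apply: cvg_trans SYo; apply: near_eq_cvg; apply: nearW => m.
    rewrite SE /w inner_suml.
    have -> : N m o = r * (\sum_(i < m) u i *: x i) o by [].
    rewrite (L2_sumE m u x) mulr_sumr -big_split/=; apply: eq_bigr => i _.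
    by rewrite Yo inner_coordL2 xE mulrDr (mulrCA r).
  - move=> j; rewrite /b.
    have -> : (\int[P h]_o ((S (j + k)%N o - S k o) ^+ 2)%:E =
        (norm2 (S (j + k)%N - S k) ^+ 2)%:E)%E by rewrite norm2_sqr_integral.
    by rewrite lee_fin lerXn2r ?nnegrE ?norm2_ge0 ?mulr_ge0 ?addr_ge0 ?norm2_ge0.
  - exact: cvg_cst.
have b0 : b k @[k --> \oo] --> 0%E.
  apply: cvg_EFin; first exact: nearW.
  rewrite [X in _ --> X](_ : _ = ((norm2 h + r) * 0) ^+ 2); last by rewrite mulr0 expr0n.
  apply: (@cvg_comp _ _ _ (fun k => (norm2 h + r) * norm2 (w k - u))
    (fun z => z ^+ 2)); last first.
    exact: exprn_continuous.
  by apply: cvgMr; exact: truncation_cvg.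
apply: (integral_moments_limit _ _ _ Zb b0).
- move=> k; rewrite /N innerZl inner_suml big1 ?mulr0// => i _.
  by rewrite x_mean mulr0.
- by move=> k; exact: noise.
- exact: truncation_cvg.
Qed.

(** * Bias and variance of the estimator in both models *)

Lemma estimator_risk (R : realType) (n V : R) (d : measure_display)
    (X : measurableType d) (mu : {measure set X -> \bar R})
    (D F G : set (L2 mu)) (T : L2 mu -> R) (u : L2 mu) (a : R)
    (d' : measure_display) (Om : measurableType d')
    (P : L2 mu -> probability Om R) (Z : Om -> R) :
  0 < n -> 0 <= V ->
  linear_functional_on D T -> F `<=` D -> G `<=` D ->
  convex_set F -> convex_set G -> limit_pair n T V F G u a ->
  (forall h, has_integral_moments (P h) (Num.sqrt n)^-1 u h Z) ->
  let That : Om -> R := fun w => a + Num.sqrt (n * V) * Z w in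
  [/\ forall h, ('V_(P h)[That] <= V%:E)%E,
      (ereal_sup [set 'E_(P f)[That] - (T f)%:E | f in F] <= bias_bound n T V F G)%E &
      (- bias_bound n T V F G <= ereal_inf [set 'E_(P g)[That] - (T g)%:E | g in G])%E].
Proof.
move=> n0 V0 linT FD GD cF cG up Zm.
have [u1 upper lower] := limit_pair_bias n0 linT FD GD cF cG up.
split.
- move=> h; have [_ VT] := affine_moments a (Num.sqrt (n * V)) (Zm h).
  apply: le_trans VT _; rewrite lee_fin exprMn norm2_sqr.
  have sn0 : Num.sqrt n != 0 by rewrite gt_eqF// sqrtr_gt0.
  (* The noise level cancels the factor [sqrt n], so the variance is at most [V * <u, u>], and
     [<u, u> <= 1]. *)
  have -> : Num.sqrt (n * V) * (Num.sqrt n)^-1 = Num.sqrt V.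
    by rewrite sqrtrM ?ltW// mulrAC mulfV// mul1r.
  by rewrite sqr_sqrtr// ler_piMr.
- apply: ge_ereal_sup => _ [f Ff <-].
  have [-> _] := affine_moments a (Num.sqrt (n * V)) (Zm f).
  exact: upper.
- apply: le_ereal_inf_tmp => _ [g Gg <-].
  have [-> _] := affine_moments a (Num.sqrt (n * V)) (Zm g).
  exact: lower.
Qed.

Theorem theorem3 (R : realType) (n V : R) (hn : 0 < n) (hV : 0 <= V) :
  (* white noise model *)
  (forall (I : interval R) (D F G : set (L2 (lebesgue_on I)))
      (T : L2 (lebesgue_on I) -> R),
    linear_functional_on D T ->
    F `<=` D -> G `<=` D ->
    convex_set F -> convex_set G -> closed2 F -> closed2 G ->
    F `&` G !=set0 ->
    (0 < omega T 1 F G)%E ->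
    forall (u : L2 (lebesgue_on I)) (a : R), limit_pair n T V F G u a ->
    forall (d : measure_display) (Om : measurableType d)
      (P : L2 (lebesgue_on I) -> probability Om R)
      (Y : R -> {mfun Om >-> R}) (Z : {mfun Om >-> R}),
    white_noise_model n P Y ->
    (forall h, is_integral_dY (P h) Y u Z) ->
    let That : Om -> R := fun w => a + Num.sqrt (n * V) * Z w in
    [/\ forall h, ('V_(P h)[That] <= V%:E)%E,
        (ereal_sup [set 'E_(P f)[That] - (T f)%:E | f in F] <= bias_bound n T V F G)%E &
        (- bias_bound n T V F G <= ereal_inf [set 'E_(P g)[That] - (T g)%:E | g in G])%E])
  /\
  (* sequence model *)
  (forall (D F G : set (L2 (counting_nat R)))
      (T : L2 (counting_nat R) -> R),
    linear_functional_on D T ->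
    F `<=` D -> G `<=` D ->
    convex_set F -> convex_set G -> closed2 F -> closed2 G ->
    F `&` G !=set0 ->
    (0 < omega T 1 F G)%E ->
    forall (u : L2 (counting_nat R)) (a : R), limit_pair n T V F G u a ->
    forall (d : measure_display) (Om : measurableType d)
      (P : L2 (counting_nat R) -> probability Om R)
      (Y : nat -> {mfun Om >-> R}) (Z : {mfun Om >-> R}),
    sequence_model n P Y ->
    (forall h, is_series_Y (P h) Y u Z) ->
    let That : Om -> R := fun w => a + Num.sqrt (n * V) * Z w in
    [/\ forall h, ('V_(P h)[That] <= V%:E)%E,
        (ereal_sup [set 'E_(P f)[That] - (T f)%:E | f in F] <= bias_bound n T V F G)%E &
        (- bias_bound n T V F G <= ereal_inf [set 'E_(P g)[That] - (T g)%:E | g in G])%E]).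
Proof.
split=> [I D F G T linT FD GD cF cG _ _ _ _ u a up d Om P Y Z model intZ
        |D F G T linT FD GD cF cG _ _ _ _ u a up d Om P Y Z model serZ].
  apply: (estimator_risk hn hV linT FD GD cF cG up) => h.
  exact: white_noise_moments model (intZ h).
apply: (estimator_risk hn hV linT FD GD cF cG up) => h.
exact: sequence_moments model (serZ h).
Qed.
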